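(* Let $X$ be a Banach space with property $(\mathfrak{su})$ and let $C\in\mathcal{B}(X)$. Then $C$ is weakly compact if and only if $C$ has the $\mathcal{G}$-FPP for the class of uniformly bi-Lipschitz affine mappings $f$ such that $\theta(f)>0$.
   Context: For a convex subset $M$ of a Banach space, $\mathcal{B}(M)$ denotes the family of all nonempty bounded, closed, convex subsets of $M$. $\mathcal{G}$-FPP (generic fixed point property): a set $C\in\mathcal{B}(X)$ has the $\mathcal{G}$-FPP for a class $\mathcal{M}$ of mappings if whenever $K\in\mathcal{B}(C)$, every $f\in\mathcal{M}$ satisfying $f(K)\subset K$ (i.e. every self-map $f\colon K\to K$ belonging to the class) has a fixed point in $K$. A map $f\colon K\to K$ is uniformly bi-Lipschitz if there exist constants $c_1,c_2>0$ such that $c_1\|x-y\|\le\|f^p(x)-f^p(y)\|\le c_2\|x-y\|$ for all $x,y\in K$ and all $p\in\mathbb{N}$, where $f^p$ is the $p$-th iterate of $f$. A map $f$ on a convex set $K$ is affine if $f(tx+(1-t)y)=tf(x)+(1-t)f(y)$ for all $x,y\in K$, $t\in[0,1]$. For a nonempty convex $K\subset X$ and an affine map $f\colon K\to K$, $\theta(f)=\inf\big\{\liminf_{n\to\infty}\|x-f^n(y)\| : x,y\in K\big\}$. Two sequences $(x_n)$, $(y_n)$ in Banach spaces are $L$-equivalent, written $(x_n)\sim_L(y_n)$, if $\frac1L\|\sum a_ix_i\|\le\|\sum a_iy_i\|\le L\|\sum a_ix_i\|$ for all finitely supported scalar sequences $(a_i)$. A weak Cauchy sequence is non-trivial if it is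 not weakly convergent. A basic sequence is a sequence which is a Schauder basis of its closed linear span. A convex block sequence of $(x_n)$ is a sequence of the form $\big(\sum_{i\in F_n}\lambda_i^n x_i\big)_n$, where $(F_n)$ are nonempty finite subsets of $\mathbb{N}$ with $\max F_n<\min F_{n+1}$ for all $n$, $\lambda^n_i\in[0,1]$, and $\sum_{i\in F_n}\lambda_i^n=1$. A basic sequence $(x_n)$ is convex block shiftable if there exist $L>0$ and a subsequence $(y_n)$ of $(x_n)$ such that every convex block sequence $(w_n)$ of $(y_n)$ satisfies $(w_{n+p})_n\sim_L(w_n)_n$ for every $p\in\mathbb{N}$. A Banach space $X$ has property $(\mathfrak{su})$ if for every non-trivial weak Cauchy sequence $(x_n)$ in $X$ there exists a convex block shiftable sequence $(w_n)$ in $X$ such that $(x_n-w_n)$ is weakly null. *)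

(* Defs.v *)
From HB Require Import structures.
From mathcomp Require Import all_boot all_order all_algebra finmap.
From mathcomp Require Import all_classical all_reals.
From mathcomp Require Import ereal topology normedtype sequences convex.

Set Implicit Arguments.
Unset Strict Implicit.
Unset Printing Implicit Defensive.

Import Order.TTheory GRing.Theory Num.Theory.
Import numFieldNormedType.Exports.

Local Open Scope classical_set_scope.
Local Open Scope ring_scope.

Definition dual {R : realType} (X : normedModType R) : Type :=
  {f : {linear X -> R^o} | continuous f}.

Definition weak {R : realType} (X : normedModType R) : topologicalType :=
  sup_topology
    (fun f : dual X => Topological.on (initial_topology (sval f : X -> R^o))).

Definition weakly_compact {R : realType} {X : normedModType R} (C : set X) :=
  compact (C : set (weak X)).

Definition weakly_cvg {R : realType} {X : normedModType R}
    (x : nat -> X) (l : X) :=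
  (x : nat -> weak X) @ \oo --> (l : weak X).

Definition weakly_null {R : realType} {X : normedModType R} (x : nat -> X) :=
  weakly_cvg x 0.

Definition weak_cauchy {R : realType} {X : normedModType R} (x : nat -> X) :=
  forall f : dual X, cauchy ((fun n => sval f (x n)) @ \oo).

Definition nontrivial_weak_cauchy {R : realType} {X : normedModType R}
    (x : nat -> X) :=
  weak_cauchy x /\ ~ exists l, weakly_cvg x l.

Definition closed_span {R : realType} {X : normedModType R} (x : nat -> X) :
    set X :=
  closure [set v | exists (n : nat) (a : nat -> R),
                     v = \sum_(0 <= i < n) a i *: x i].

(* Uniqueness of the expansion of 0 forces every x n to be nonzero. *)
Definition basic_sequence {R : realType} {X : normedModType R}
    (x : nat -> X) :=
  forall v, closed_span x v ->
    exists! a : nat -> R, series (fun i => a i *: x i) @ \oo --> v.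

(* A finitely supported scalar sequence is represented by an arbitrary [a]
   truncated at [n]. *)
Definition equivalent_sequences {R : realType} {X Y : normedModType R} (L : R)
    (x : nat -> X) (y : nat -> Y) :=
  forall (n : nat) (a : nat -> R),
    L^-1 * `|\sum_(0 <= i < n) a i *: x i| <= `|\sum_(0 <= i < n) a i *: y i|
    /\ `|\sum_(0 <= i < n) a i *: y i| <= L * `|\sum_(0 <= i < n) a i *: x i|.

Definition subsequence {T : Type} (x y : nat -> T) :=
  exists2 k : nat -> nat, {homo k : m n / (m < n)%N} & y = x \o k.

Definition convex_block_sequence {R : realType} {X : normedModType R}
    (x w : nat -> X) :=
  exists (F : nat -> {fset nat}) (lam : nat -> nat -> R),
    [/\ forall n, F n != fset0,
        forall n i j, i \in F n -> j \in F n.+1 -> (i < j)%N,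
        forall n i, i \in F n -> 0 <= lam n i <= 1,
        forall n, \sum_(i <- F n) lam n i = 1
      & forall n, w n = \sum_(i <- F n) lam n i *: x i].

Definition convex_block_shiftable {R : realType} {X : normedModType R}
    (x : nat -> X) :=
  basic_sequence x /\
  exists L : R, 0 < L /\
    exists2 y, subsequence x y &
      forall w, convex_block_sequence y w ->
        forall p : nat, equivalent_sequences L (fun n => w (n + p)%N) w.

Definition property_su {R : realType} (X : normedModType R) :=
  forall x : nat -> X, nontrivial_weak_cauchy x ->
    exists2 w : nat -> X, convex_block_shiftable w &
      weakly_null (fun n => x n - w n).

(* [bcc_subsets M] is the family B(M). *)
Definition bcc_subsets {R : realType} {X : normedModType R} (M : set X) :
    set (set X) :=
  [set K | [/\ K `<=` M, K !=set0, bounded_set K, closed K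
             & convex_set (K : set (convex_lmodType X))]].

(* A self-map of K is represented by a total map [f : X -> X] with
   [set_fun K K f]; [cls K f] says that the restriction of f to K belongs to
   the class, and should only depend on the values of f on K. *)
Definition generic_fpp {R : realType} {X : normedModType R}
    (cls : set X -> set (X -> X)) (C : set X) :=
  forall K, bcc_subsets C K ->
    forall f : X -> X, set_fun K K f -> cls K f ->
      exists2 x, K x & f x = x.

Definition uniformly_bilipschitz {R : realType} {X : normedModType R}
    (K : set X) (f : X -> X) :=
  exists c1 c2 : R, [/\ 0 < c1, 0 < c2 &
    forall x y, K x -> K y -> forall p : nat,
      c1 * `|x - y| <= `|iter p f x - iter p f y| <= c2 * `|x - y|].

Definition affine_on {R : realType} {X : normedModType R}
    (K : set X) (f : X -> X) :=
  forall x y, K x -> K y -> forall t : R, 0 <= t <= 1 ->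
    f (t *: x + (1 - t) *: y) = t *: f x + (1 - t) *: f y.

Definition theta {R : realType} {X : normedModType R}
    (K : set X) (f : X -> X) : \bar R :=
  ereal_inf [set limn_einf (fun n => `|x - iter n f y|%:E) | x in K & y in K].

(* Main.v *)
Require Import Defs.
From HB Require Import structures.
From mathcomp Require Import all_boot all_order all_algebra finmap.
From mathcomp Require Import ring lra.
From mathcomp Require Import all_classical all_reals.
From mathcomp Require Import ereal topology normedtype sequences convex.

Set Implicit Arguments.
Unset Strict Implicit.
Unset Printing Implicit Defensive.

Import Order.TTheory GRing.Theory Num.Theory.
Import numFieldNormedType.Exports.

Local Open Scope classical_set_scope.
Local Open Scope ring_scope.

(** Weak compactness gives a fixed point by averaging: the Cesaro means of an
    orbit of an affine map move less and less, the points moved by at most [e]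
    form a closed convex set, and closed convex sets are weakly closed
    ([affine_fixed_point]).

    Conversely, let [C] fail to be weakly compact.  An ultrafilter on [C] without
    weak limit has a limit functional [phi] on the dual space, and completeness
    of [X] keeps [phi] at positive distance from the points of [X].  Helly's
    lemma then yields, one after the other, functionals [f n] of the dual ball and
    points [x n] of [C] with [f n (x k) = 0] for [k < n] and [f n (x k)] close to
    a constant [c > 0] for [n <= k] ([james_sequence_exists]).  Such a sequence
    dominates the summing basis ([james_coefficient_le]), which bounds every
    coefficient by the norm of the combination, and this is inherited by convex
    blocks ([james_convex_block]).

    If moreover the norm of a combination of the [u n] is equivalent to the norms
    of all its shifts, uniformly in the shift, then the map sending
    [\sum_i t_i u_i] to [\sum_i t_i u_(i+1)] extends to the closed convex hull [K]
    of the [u n], is affine and uniformly bi-Lipschitz there, and the functionals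
    [f n] keep [x] away from the [n]-th image of [y] for all [x], [y] in [K]
    ([shift_map_separation]).  So theta is positive and there is no fixed point.

    It remains to find such a sequence inside [C].  By Rosenthal's dichotomy
    ([rosenthal_dichotomy]) some subsequence of [x] is equivalent to the basis of
    l1, where shifts are harmless, or is weak Cauchy.  In the second case it has no
    weak limit ([james_not_weakly_cvg]), so the property of the space provides a
    sequence [w] whose convex blocks are uniformly equivalent to their shifts, with
    [x - w] weakly null.  By Mazur's lemma suitable common convex blocks of [x] and
    of [w] are as close in norm as desired; the blocks of [x] lie in [C], and
    the coefficient bound makes the equivalence survive the perturbation
    ([shift_equivalent_perturbation]). *)

(** * The Hahn-Banach theorem *)

Definition sublinear {R : realType} {V : lmodType R} (p : V -> R) :=
  (forall x y, p (x + y) <= p x + p y) /\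
  (forall t x, 0 < t -> p (t *: x) <= t * p x).

Lemma sublinear0 {R : realType} {V : lmodType R} (p : V -> R) :
  sublinear p -> p 0 = 0.
Proof.
move=> [pD pZ]; apply/eqP; rewrite eq_le; apply/andP; split.
  have := pZ 2^-1 0; rewrite scaler0 => /(_ ltac:(by rewrite invr_gt0)).
  by move=> h; lra.
by have := pD 0 0; rewrite addr0 => h; lra.
Qed.

Lemma sublinearN {R : realType} {V : lmodType R} (p : V -> R) x :
  sublinear p -> - p (- x) <= p x.
Proof.
move=> sp; have := sp.1 x (- x); rewrite subrr sublinear0// => h; lra.
Qed.

(** Used twice: for infimal convolutions and for chains of sublinear functionals.
    In both cases the family is directed enough for the two inequalities to pass
    to the pointwise infimum, which [m] keeps finite. *)
Lemma inf_sublinear {R : realType} {V : lmodType R} (G : set (V -> R))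
    (m : V -> R) :
  G !=set0 -> (forall g w, G g -> m w <= g w) ->
  (forall g1 g2 x y, G g1 -> G g2 ->
     exists2 g, G g & g (x + y) <= g1 x + g2 y) ->
  (forall g t x, G g -> 0 < t -> exists2 g', G g' & g' (t *: x) <= t * g x) ->
  exists2 q, sublinear q & forall g w, G g -> q w <= g w.
Proof.
move=> [g0 Gg0] mG GD GZ.
pose q (w : V) : R := inf [set g w | g in G].
have qle g w : G g -> q w <= g w.
  by move=> Gg; apply: ge_inf; [exists (m w) => _ [h Gh <-]; exact: mG|exists g].
have qge w r : (forall g, G g -> r <= g w) -> r <= q w.
  by move=> h; apply: lb_le_inf; [exists (g0 w), g0|move=> _ [g Gg <-]; exact: h].
exists q => //; split=> [x y|t x t0].
  rewrite -lerBlDl; apply: (qge) => g2 Gg2; rewrite lerBlDl -lerBlDr.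
  apply: (qge) => g1 Gg1; rewrite lerBlDr.
  by have [g Gg /(le_trans (qle _ _ Gg))] := GD g1 g2 x y Gg1 Gg2.
rewrite -ler_pdivrMl//; apply: (qge) => g Gg; rewrite ler_pdivrMl//.
by have [g' Gg' /(le_trans (qle _ _ Gg'))] := GZ g t x Gg t0.
Qed.

(** A convex cone of constraints: a pair [(v, s)] in [A] demands [s <= f v] from
    the linear functional [f] to be found below [p]. *)
Definition cone_below {R : realType} {V : lmodType R} (p : V -> R)
    (A : set (V * R)) :=
  [/\ A (0, 0), forall a b, A a -> A b -> A (a.1 + b.1, a.2 + b.2),
      forall t a, 0 < t -> A a -> A (t *: a.1, t * a.2)
    & forall a, A a -> a.2 <= p a.1].

(** The infimal convolution of [p] with the cone [A]: lowering [p] to the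
    infimum of [p (w + v) - s] over [(v, s)] in [A] forces every functional
    below the new [q] to be at least [s] at [v]. *)
Lemma lower_sublinear {R : realType} {V : lmodType R} (p : V -> R)
    (A : set (V * R)) : sublinear p -> cone_below p A ->
  exists2 q, sublinear q & forall w a, A a -> q w <= p (w + a.1) - a.2.
Proof.
move=> sp [A0 AD AZ Ap].
pose G := [set g | exists2 a, A a & g = fun w => p (w + a.1) - a.2].
have [||||q sq qG] := @inf_sublinear _ _ G (fun w => - p (- w)).
- by exists (fun w => p (w + 0) - 0), (0, 0).
- move=> _ w [a Aa ->]; rewrite lerBrDr.
  have := Ap _ Aa; have := sp.1 (w + a.1) (- w).
  by rewrite addrAC subrr add0r => h1 h2; lra.
- move=> _ _ x y [a Aa ->] [b Ab ->].
  exists (fun w => p (w + (a.1 + b.1)) - (a.2 + b.2)).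
    by exists (a.1 + b.1, a.2 + b.2) => //; exact: AD.
  have := sp.1 (x + a.1) (y + b.1); rewrite addrACA => h; lra.
- move=> _ t x [a Aa ->] t0.
  exists (fun w => p (w + (t *: a.1)) - (t * a.2)).
    by exists (t *: a.1, t * a.2) => //; exact: AZ.
  by rewrite -scalerDr mulrBr lerB//; exact: sp.2.
exists q => // w a Aa; apply: (qG (fun w => p (w + a.1) - a.2)).
by exists a.
Qed.

(** A minimal sublinear functional [q] is linear: lowering it along the ray
    spanned by [(v, q v)] cannot change it, so [q w + q v <= q (w + v)]. *)
Lemma minimal_sublinear_additive {R : realType} {V : lmodType R} (q : V -> R) :
  sublinear q ->
  (forall q', sublinear q' -> (forall w, q' w <= q w) ->
     forall w, q w <= q' w) ->
  forall x y, q (x + y) = q x + q y.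
Proof.
move=> sq qmin x v; apply/eqP; rewrite eq_le sq.1/=.
pose A : set (V * R) := [set a | exists2 t, 0 <= t & a = (t *: v, t * q v)].
have cA : cone_below q A.
  split.
  - by exists 0 => //; rewrite scale0r mul0r.
  - move=> _ _ [t t0 ->] [s s0 ->]; exists (t + s); first exact: addr_ge0.
    by rewrite scalerDl mulrDl.
  - move=> t _ t0 [s s0 ->]; exists (t * s); first by rewrite mulr_ge0// ltW.
    by rewrite scalerA mulrA.
  - move=> _ [t t0 ->] /=; move: t0; rewrite le_eqVlt => /predU1P[<-|t0].
      by rewrite mul0r scale0r sublinear0.
    have ti : 0 < t^-1 by rewrite invr_gt0.
    rewrite -ler_pdivlMl//; apply: le_trans (sq.2 _ _ ti).
    by rewrite scalerA mulVf ?scale1r// gt_eqF.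
have [q' sq' q'A] := lower_sublinear sq cA.
have q'q w : q' w <= q w.
  have := q'A w (0, 0); rewrite /= addr0 subr0; apply.
  by exists 0 => //; rewrite scale0r mul0r.
have := qmin _ sq' q'q x.
have /(q'A x) : A (v, q v) by exists 1 => //; rewrite scale1r mul1r.
by move=> /= h1 h2; lra.
Qed.

Lemma additive_sublinear_linear {R : realType} {V : lmodType R} (q : V -> R) :
  sublinear q -> (forall x y, q (x + y) = q x + q y) ->
  exists f : {linear V -> R^o}, forall v, f v = q v.
Proof.
move=> sq qD.
have qN x : q (- x) = - q x.
  by apply/eqP; rewrite -addr_eq0 -qD addNr sublinear0.
have qZp t x : 0 < t -> q (t *: x) = t * q x.
  move=> t0; apply/eqP; rewrite eq_le (sq.2 _ _ t0)/=.
  have ti : 0 < t^-1 by rewrite invr_gt0.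
  rewrite -ler_pdivlMl//; apply: le_trans (sq.2 _ _ ti).
  by rewrite scalerA mulVf ?scale1r// gt_eqF.
have qZ t x : q (t *: x) = t * q x.
  have [t0|t0|->] := ltgtP t 0; last by rewrite scale0r mul0r sublinear0.
    have := qZp (- t) x; rewrite oppr_gt0 scaleNr qN => /(_ t0) h; lra.
  exact: qZp.
have ql : linear (q : V -> R^o) by move=> a x y; rewrite qD qZ.
by exists (HB.pack_for {linear V -> R^o} (q : V -> R^o)
  (GRing.isLinear.Build R V R^o *:%R q ql)).
Qed.

(** Zorn's lemma, with the pointwise infimum of a chain as its bound, provides a
    minimal sublinear functional below [p]. *)
Lemma sublinear_dominates_linear {R : realType} {V : lmodType R} (p : V -> R) :
  sublinear p -> exists f : {linear V -> R^o}, forall v, f v <= p v.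
Proof.
move=> sp.
pose T := {q : V -> R | sublinear q /\ forall v, q v <= p v}.
pose p0 : T := exist _ p (conj sp (fun v => lexx (p v))).
pose Le (q1 q2 : T) := `[< forall v, sval q2 v <= sval q1 v >].
have [|||q qmin] := @ZL_preorder T p0 Le.
- by move=> q; apply/asboolP.
- move=> q1 q2 q3 /asboolP h12 /asboolP h23; apply/asboolP => v.
  exact: le_trans (h12 v).
- move=> A Atot.
  have [[q0 Aq0]|/set0P/negP/negPn/eqP A0] := pselect (A !=set0); last first.
    by exists p0 => s; rewrite A0.
  have [||||q sq qA] := @inf_sublinear _ _ [set sval s | s in A]
      (fun w => - p (- w)).
  + by exists (sval q0), q0.
  + move=> _ w [s As <-]; apply: le_trans (sublinearN _ (svalP s).1).
    by rewrite lerN2; exact: (svalP s).2.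
  + move=> _ _ x y [s1 As1 <-] [s2 As2 <-].
    have [/asboolP h|/asboolP h] := Atot _ _ As1 As2.
      exists (sval s2); first by exists s2.
      by apply: le_trans ((svalP s2).1.1 _ _) _; rewrite lerD2r.
    exists (sval s1); first by exists s1.
    by apply: le_trans ((svalP s1).1.1 _ _) _; rewrite lerD2l.
  + move=> _ t x [s As <-] t0; exists (sval s); first by exists s.
    exact: (svalP s).1.2.
  have qp v : q v <= p v.
    by apply: le_trans (qA (sval q0) v _) ((svalP q0).2 v); exists q0.
  exists (exist _ q (conj sq qp)) => s As; apply/asboolP => v /=.
  by apply: qA; exists s.
have [sq qp] := svalP q.
have qD : forall x y, sval q (x + y) = sval q x + sval q y.
  apply: minimal_sublinear_additive => // q' sq' q'q.
  have q'p v : q' v <= p v by exact: le_trans (q'q v) (qp v).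
  have /qmin/asboolP h : Le q (exist _ q' (conj sq' q'p)) by apply/asboolP.
  exact: h.
have [f fq] := additive_sublinear_linear sq qD.
by exists f => v; rewrite fq.
Qed.

(** Hahn-Banach in the form of Mazur and Orlicz.  Every separation or extension
    statement below is the choice of a suitable cone [A]. *)
Lemma mazur_orlicz {R : realType} {V : lmodType R} (p : V -> R)
    (A : set (V * R)) : sublinear p -> cone_below p A ->
  exists f : {linear V -> R^o},
    (forall v, f v <= p v) /\ forall a, A a -> a.2 <= f a.1.
Proof.
move=> sp cA; have [q sq qA] := lower_sublinear sp cA.
have [f fq] := sublinear_dominates_linear sq.
case: cA => A0 _ _ _.
exists f; split=> [v|a Aa].
  by have := le_trans (fq v) (qA v _ A0); rewrite /= addr0 subr0.
have := le_trans (fq (- a.1)) (qA (- a.1) _ Aa).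
by rewrite addNr sublinear0// sub0r raddfN lerN2.
Qed.

(** * The dual unit ball and the weak topology *)

Definition dual_ball {R : realType} {X : normedModType R} :
    set {linear X -> R^o} :=
  [set f | forall v, `|f v| <= `|v|].

Definition convex_closed {R : realType} {X : lmodType R} (K : set X) :=
  forall x y t, K x -> K y -> 0 <= t <= 1 -> K (t *: x + (1 - t) *: y).

Section dual_ball.
Context {R : realType} {X : normedModType R}.
Implicit Types (f : {linear X -> R^o}) (K : set X).

Lemma convex_setP K : convex_set (K : set (convex_lmodType X)) <->
  convex_closed K.
Proof.
split=> [cK x y t Kx Ky /andP[t0 t1]|cK x y t].
  have := cK x y (Itv01 t0 t1) (mem_set Kx) (mem_set Ky).
  by move/set_mem.
move=> /set_mem Kx /set_mem Ky; apply/mem_set.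
by apply: cK => //; rewrite ge0 le1.
Qed.

Lemma dual_ballP f : (forall v, f v <= `|v|) -> dual_ball f.
Proof.
move=> fn v; rewrite ler_norml fn andbT lerNl.
by have := fn (- v); rewrite raddfN normrN.
Qed.

Lemma sublinear_norm : sublinear (fun v : X => `|v|).
Proof.
by split=> [x y|t x t0]; [exact: ler_normD|rewrite normrZ gtr0_norm].
Qed.

Lemma norming_functional (v : X) : exists2 f, dual_ball f & f v = `|v|.
Proof.
pose A : set (X * R) :=
  [set a | exists2 t, 0 <= t & a = (t *: v, t * `|v|)].
have [|f [fn fA]] := @mazur_orlicz _ _ _ A sublinear_norm.
  split.
  - by exists 0 => //; rewrite scale0r mul0r.
  - move=> _ _ [t t0 ->] [s s0 ->]; exists (t + s); first exact: addr_ge0.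
    by rewrite scalerDl mulrDl.
  - move=> t _ t0 [s s0 ->]; exists (t * s); first by rewrite mulr_ge0// ltW.
    by rewrite scalerA mulrA.
  - by move=> _ [t t0 ->] /=; rewrite normrZ ger0_norm.
exists f; first exact: dual_ballP.
apply/eqP; rewrite eq_le fn/=; apply: (fA (v, `|v|)).
by exists 1 => //; rewrite scale1r mul1r.
Qed.

Lemma norm_le_dual (v : X) (r : R) :
  (forall f, dual_ball f -> f v <= r) -> `|v| <= r.
Proof. by have [f bf <-] := norming_functional v; apply. Qed.

(** Hahn-Banach for the cone spanned by the pairs [(k - x, d)]; its convexity is
    that of [K]. *)
Lemma convex_separation K (x : X) (d : R) : K !=set0 -> convex_closed K ->
  0 <= d -> (forall k, K k -> d <= `|k - x|) ->
  exists2 f, dual_ball f & forall k, K k -> f x + d <= f k.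
Proof.
move=> [k0 Kk0] cK d0 Kd.
pose A : set (X * R) :=
  [set a | exists t k, [/\ 0 <= t, K k & a = (t *: (k - x), t * d)]].
have [|f [fn fA]] := @mazur_orlicz _ _ _ A sublinear_norm.
  split.
  - by exists 0, k0; rewrite scale0r mul0r.
  - move=> _ _ [t [k [t0 Kk ->]]] [s [l [s0 Kl ->]]] /=.
    have [ts0|ts0] := eqVneq (t + s) 0.
      have -> : t = 0 by lra.
      have -> : s = 0 by lra.
      by exists 0, k; rewrite !scale0r !mul0r !addr0.
    have tsp : 0 < t + s by rewrite lt_neqAle eq_sym ts0 addr_ge0.
    exists (t + s), ((t / (t + s)) *: k + (1 - t / (t + s)) *: l); split=> //.
    + exact: addr_ge0.
    + apply: cK => //; apply/andP; split; first by rewrite divr_ge0// ltW.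
      by rewrite ler_pdivrMr// mul1r lerDl.
    + congr (_, _); last by rewrite mulrDl.
      rewrite !scalerBr scalerDr !scalerA.
      rewrite (_ : (t + s) * (t / (t + s)) = t); last by field.
      rewrite (_ : (t + s) * (1 - t / (t + s)) = s); last by field.
      by rewrite scalerDl opprD addrACA.
  - move=> t _ t0 [s [k [s0 Kk ->]]]; exists (t * s), k; split=> //.
      by rewrite mulr_ge0// ltW.
    by rewrite /= scalerA mulrA.
  - move=> _ [t [k [t0 Kk ->]]] /=; rewrite normrZ ger0_norm//.
    by rewrite ler_wpM2l// Kd.
exists f; first exact: dual_ballP.
move=> k Kk; have /fA /= : A (k - x, d).
  by exists 1, k; rewrite scale1r mul1r.
by rewrite linearB -lerBrDl.
Qed.

Lemma dual_ball_continuous f : dual_ball f -> continuous f.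
Proof.
move=> bf; apply/bounded_linear_continuous/bounded_funP => r.
by exists r => x xr; exact: le_trans (bf x) xr.
Qed.

Lemma continuous_dual_ball f : continuous f ->
  exists2 g : {linear X -> R^o}, dual_ball g &
    exists2 k : R, 0 < k & forall v, f v = k * g v.
Proof.
move=> /(_ 0)/continuous_linear_bounded => /(_ 0)/linear_boundedP.
move=> /pinfty_ex_gt0[k k0 fk].
have gl : linear (fun v => k^-1 * f v : R^o).
  move=> a x y; rewrite linearP /= mulrDr; congr (_ + _).
  by rewrite /GRing.scale/= mulrCA.
exists (HB.pack_for {linear X -> R^o} (fun v => k^-1 * f v : R^o)
  (GRing.isLinear.Build R X R^o *:%R _ gl)).
  move=> v /=; rewrite normrM gtr0_norm ?invr_gt0// ler_pdivrMl//.
exists k => // v /=; by rewrite mulVKf// gt_eqF.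
Qed.

(** Scaling reduces continuous functionals to those of the dual ball. *)
Lemma weak_cvgP (F : set_system X) (l : X) : Filter F ->
  F --> (l : weak X) <-> forall f, dual_ball f -> f x @[x --> F] --> f l.
Proof.
move=> FF; rewrite /weak.
split=> [Fl f bf|Ff].
  pose g : dual X := exist _ f (dual_ball_continuous bf).
  move/cvg_sup : Fl => /(_ g) Fl.
  apply: cvg_comp Fl _.
  exact: (@initial_continuous _ _ (sval g : X -> R^o)).
apply/cvg_sup => -[f cf].
have [g bg [k k0 fg]] := continuous_dual_ball cf.
have {bg}Ffl : f x @[x --> F] --> f l.
  rewrite fg (_ : f = (fun v => k *: (g v : R^o)) :> (X -> R^o)).
    by apply: cvgZl_tmp; exact: Ff.
  by apply/funext => v; rewrite fg.
move=> A /= [_ [[B Bop <-] Bfs sBfA]]; rewrite nbhs_filterE.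
apply: filterS sBfA _; apply: Ffl.
exact: open_nbhs_nbhs.
Qed.

(** Mazur: norm-closed convex sets are weakly closed. *)
Lemma convex_closed_weak_closed K (F : set_system X) (l : X) : ProperFilter F ->
  convex_closed K -> closed K -> F K ->
  (forall f, dual_ball f -> f x @[x --> F] --> f l) -> K l.
Proof.
move=> FF cK clK FK Fl; apply: clK => B /nbhs_ballP[d /= d0 dB].
apply: contrapT => KB0.
have Kd k : K k -> d <= `|k - l|.
  move=> Kk; rewrite leNgt; apply/negP => kd; apply: KB0; exists k; split=> //.
  by apply: dB; rewrite -ball_normE/= distrC.
have [f bf fK] := convex_separation (filter_ex FK) cK (ltW d0) Kd.
have /cvgrPdist_lt/(_ d d0) Ffl := Fl f bf.
have [k [Kk]] := filter_ex (filterI FK Ffl).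
have := fK k Kk; rewrite ltNge => h /negP; apply.
by rewrite distrC; apply: le_trans (ler_norm _); rewrite lerBrDl.
Qed.
End dual_ball.

(** * The dual space and Helly's lemma *)

Section bdual.
Context {R : realType} {X : normedModType R}.

Definition bounded_linear : {pred X -> R^o} :=
  [pred f | `[< linear f /\ exists k, forall v, `|f v| <= k * `|v| >]].

Lemma bounded_linear_submod_closed : submod_closed bounded_linear.
Proof.
split=> [|a f g /asboolP[fl [k fk]] /asboolP[gl [l gl']]]; apply/asboolP.
  split; first by move=> a x y; rewrite /= scaler0 addr0.
  by exists 0 => v; rewrite normr0 mul0r.
split=> [b x y|].
  rewrite /= !fctE fl gl !scalerDr !scalerA (mulrC a b) -!addrA; congr (_ + _).
  by rewrite addrCA.
exists (`|a| * k + l) => v; rewrite !fctE mulrDl (le_trans (ler_normD _ _))//.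
by rewrite lerD// normrM -mulrA ler_wpM2l.
Qed.

HB.instance Definition _ := GRing.isSubmodClosed.Build R (X -> R^o)
  bounded_linear bounded_linear_submod_closed.

Record bdual := Bdual { bdual_fun :> X -> R^o ;
                        _ : bdual_fun \in bounded_linear }.

HB.instance Definition _ := [isSub for bdual_fun].
HB.instance Definition _ := [Choice of bdual by <:].
HB.instance Definition _ := [SubChoice_isSubLmodule of bdual by <:].

Lemma bdual_funP (f : bdual) : linear f.
Proof. by case: f => f /= /asboolP[]. Qed.

HB.instance Definition _ (f : bdual) :=
  GRing.isLinear.Build R X R^o *:%R (bdual_fun f) (bdual_funP f).

Lemma bdual_bounded (f : bdual) : exists k, forall v, `|f v| <= k * `|v|.
Proof. by case: f => f /= /asboolP[]. Qed.

Lemma bdualD (f g : bdual) v : (f + g) v = f v + g v.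
Proof. by []. Qed.

Lemma bdualN (f : bdual) v : (- f) v = - f v.
Proof. by []. Qed.

Lemma bdualZ a (f : bdual) v : (a *: f) v = a * f v.
Proof. by []. Qed.

Lemma dual_ball_bdual (f : {linear X -> R^o}) : dual_ball f ->
  exists g : bdual, forall v, g v = f v.
Proof.
move=> bf.
have fP : (f : X -> R^o) \in bounded_linear.
  by apply/asboolP; split; [exact: linearP|exists 1 => v; rewrite mul1r].
by exists (Bdual fP).
Qed.
End bdual.
Arguments bdual {R} X.

Section helly.
Context {R : realType} {X : normedModType R}.
Implicit Types (f g : bdual X).

Definition opnorm f : R := sup [set `|f v| | v in [set v | `|v| <= 1]].

Lemma opnorm_le f v : `|f v| <= opnorm f * `|v|.
Proof.
have [k fk] := bdual_bounded f.
have [->|v0] := eqVneq v 0; first by rewrite linear0 !normr0 mulr0.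
have nv : 0 < `|v| by rewrite normr_gt0.
rewrite -ler_pdivrMr//.
have -> : `|f v| / `|v| = `|f (`|v|^-1 *: v)|.
  by rewrite linearZ normrZ ger0_norm ?invr_ge0// mulrC.
apply: ub_le_sup; last first.
  by exists (`|v|^-1 *: v) => //=; rewrite normrZ ger0_norm ?invr_ge0// mulVf ?gt_eqF.
exists `|k| => _ [w /= w1 <-]; apply: le_trans (fk w) _.
by rewrite (le_trans (ler_wpM2r _ (ler_norm k)))// ler_piMr.
Qed.

Lemma opnorm_bound f (k : R) : (forall v, `|f v| <= k * `|v|) -> 0 <= k ->
  opnorm f <= k.
Proof.
move=> fk k0; apply: ge_sup; first by exists `|f 0|, 0 => //=; rewrite normr0.
by move=> _ [w /= w1 <-]; apply: le_trans (fk w) _; rewrite ler_piMr.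
Qed.

Lemma opnorm_ge0 f : 0 <= opnorm f.
Proof.
have [[v v0]|h] := pselect (exists v : X, v != 0).
  rewrite -(@pmulr_lge0 _ `|v|) ?normr_gt0//.
  by apply: le_trans (opnorm_le f v).
rewrite /opnorm (_ : [set _ | _ in _] = [set 0]) ?sup1//.
have X0 v : v = 0 :> X by apply: contrapT => /eqP v0; apply: h; exists v.
apply/seteqP; split=> [_ [v _ <-]|_ ->] /=; first by rewrite (X0 v) linear0 normr0.
by exists 0 => //=; rewrite ?normr0// linear0 normr0.
Qed.

Lemma opnorm_sublinear (c : R) : 0 <= c -> sublinear (fun f => c * opnorm f).
Proof.
move=> c0; split=> [f g|t f t0].
  rewrite -mulrDr ler_wpM2l// opnorm_bound ?addr_ge0 ?opnorm_ge0// => v.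
  rewrite bdualD (le_trans (ler_normD _ _))//.
  by rewrite mulrDl lerD ?opnorm_le.
rewrite mulrCA ler_wpM2l// opnorm_bound ?mulr_ge0 ?opnorm_ge0// 1?ltW// => v.
rewrite bdualZ normrM gtr0_norm//.
by rewrite -mulrA ler_wpM2l ?opnorm_le// ltW.
Qed.

(** A functional vanishing on the common kernel of finitely many evaluations is a
    linear combination of them, hence itself an evaluation.  The induction step
    subtracts the multiple of the evaluation at [y0] given by a witness [e] that
    separates [y0] from [s]. *)
Lemma evaluation_of_kernel (s : seq X) (psi : bdual X -> R^o) : linear psi ->
  (forall f, (forall y, y \in s -> f y = 0) -> psi f = 0) ->
  exists y, forall f, psi f = f y.
Proof.
elim: s psi => [|y0 s IHs] psi psil psi0.
  by exists 0 => f; rewrite linear0 psi0.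
have psiZ a f : psi (a *: f) = a * psi f.
  have := psil a f 0; rewrite !addr0 => ->.
  suff -> : psi 0 = 0 by rewrite addr0.
  by have := psil (-1) 0 0; rewrite scaler0 addr0 scaleN1r addNr.
have psiD f g : psi (f + g) = psi f + psi g.
  by have := psil 1 f g; rewrite !scale1r.
have [[e [es ey0]]|noe] :=
    pselect (exists e : bdual X, (forall y, y \in s -> e y = 0) /\ e y0 != 0).
  pose a := psi e / e y0.
  have [||y Hy] := IHs (fun f => psi f - a * f y0).
  - move=> b f g; rewrite psil /= mulrDr opprD addrACA; congr (_ + _).
    by rewrite /GRing.scale /= mulrBr; congr (_ - _); rewrite mulrCA.
  - move=> f fs.
    have : psi (f - (f y0 / e y0) *: e) = 0.
      apply: psi0 => y; rewrite inE bdualD bdualN bdualZ => /predU1P[->|ys].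
        by rewrite divfK// subrr.
      by rewrite (fs y)// (es y)// mulr0 subr0.
    by rewrite -scaleNr psiD psiZ /a => h; rewrite -[RHS]h; field.
  exists (y + a *: y0) => f; rewrite linearD linearZ /= -Hy.
  by rewrite /GRing.scale /= subrK.
have [||y Hy] := IHs psi; [by []| |by exists y] => f fs.
apply: psi0 => y; rewrite inE => /predU1P[->|/fs//].
by apply: contrapT => /eqP fy0; apply: noe; exists f.
Qed.

(** Helly.  If no [f] worked, [phi] would be at most [c] times the norm on
    the annihilator of [s].  Extending that restriction to [psi] of norm at most
    [c], the difference [phi - psi] kills the annihilator, hence is the
    evaluation at a point at distance at most [c] from [phi]. *)
Lemma helly (phi : bdual X -> R^o) (c : R) (s : seq X) : linear phi -> 0 < c ->
  (forall y, exists2 f : bdual X, dual_ball f & c < `|phi f - f y|) ->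
  exists f : bdual X, [/\ dual_ball f, forall y, y \in s -> f y = 0
                     & phi f = c].
Proof.
move=> phil c0 far; apply: contrapT => nof.
have phiZ a f : phi (a *: f) = a * phi f.
  have := phil a f 0; rewrite !addr0 => ->.
  suff -> : phi 0 = 0 by rewrite addr0.
  by have := phil (-1) 0 0; rewrite scaler0 addr0 scaleN1r addNr.
have phiD f g : phi (f + g) = phi f + phi g.
  by have := phil 1 f g; rewrite !scale1r.
have small f : (forall y, y \in s -> f y = 0) -> phi f <= c * opnorm f.
  move=> fs; rewrite leNgt; apply/negP => cf; apply: nof.
  have pf : 0 < phi f by apply: le_lt_trans cf; rewrite mulr_ge0 ?opnorm_ge0// ltW.
  exists ((c / phi f) *: f); split.
  - suff h v : `|((c / phi f) *: f) v| <= `|v| by [].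
    rewrite bdualZ normrM gtr0_norm ?divr_gt0//.
    rewrite mulrAC ler_pdivrMr//.
    apply: (@le_trans _ _ (c * (opnorm f * `|v|))).
      by rewrite ler_wpM2l ?opnorm_le// ltW.
    by rewrite mulrA [leRHS]mulrC ler_wpM2r// ltW.
  - by move=> y ys; rewrite bdualZ fs// mulr0.
  - by rewrite phiZ divfK// gt_eqF.
pose A : set (bdual X * R) :=
  [set a : bdual X * R | (forall y, y \in s -> a.1 y = 0) /\ a.2 = phi a.1].
have [|psi [psic psiA]] := mazur_orlicz (opnorm_sublinear (ltW c0)) (A := A).
  split.
  - by split=> //=; have := phiZ 0 0; rewrite scale0r mul0r.
  - move=> [f r] [g t] [/= fs ->] [/= gs ->]; split=> [y ys|/=]; last by rewrite phiD.
    suff : (f + g) y = 0 by [].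
    by rewrite bdualD fs// gs// addr0.
  - move=> t [f r] t0 [/= fs ->]; split=> [y ys|/=]; last by rewrite phiZ.
    suff : (t *: f) y = 0 by [].
    by rewrite bdualZ fs// mulr0.
  - by move=> [f r] [/= fs ->]; exact: small.
have [||y Hy] := @evaluation_of_kernel s (fun f => phi f - psi f).
- move=> a f g; rewrite phil linearP /= scalerBr opprD addrACA//.
- move=> f fs; apply/eqP; rewrite eq_le; apply/andP; split.
    by rewrite subr_le0; apply: (psiA (f, phi f)).
  have : - phi f <= - psi f.
    rewrite -[- phi f]mulN1r -phiZ scaleN1r -(raddfN psi).
    apply: (psiA (- f, phi (- f))); split=> // y ys.
    suff : (- f) y = 0 by [].
    by rewrite bdualN fs// oppr0.
  by rewrite lerN2 subr_ge0.
have [f bf] := far y; rewrite -Hy (_ : phi f - _ = psi f); last first.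
  by rewrite opprB addrCA subrr addr0.
apply/negP; rewrite -leNgt ler_norml; apply/andP; split.
  rewrite lerNl -(raddfN psi); apply: le_trans (psic _) _.
  rewrite ler_piMr ?(ltW c0)// opnorm_bound// => v.
  by rewrite mul1r bdualN normrN; exact: bf.
apply: le_trans (psic _) _.
by rewrite ler_piMr ?(ltW c0)// opnorm_bound// => v; rewrite mul1r; exact: bf.
Qed.
End helly.

(** * The limit functional of a set that is not weakly compact *)

Section limit_functional.
Context {R : realType}.

(** The limit along an ultrafilter: a cluster point, which exists by
    compactness of the segment, is a limit because an ultrafilter decides every
    set. *)
Lemma ultra_bounded_cvg T (F : set_system T) (g : T -> R) (M : R) :
  UltraFilter F -> F [set x | `|g x| <= M] ->
  exists l : R, g x @[x --> F] --> l.
Proof.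
move=> UF FM.
have gF : F (g @^-1` `[- M, M]).
  by apply: filterS FM => x /=; rewrite in_itv/= ler_norml.
have [l [_ cl]] := @segment_compact R (- M) M (g @ F) _ gF.
exists l => A lA; rewrite /nbhs/=.
have [//|FnA] := in_ultra_setVsetC (g @^-1` A) UF.
by have [y []] : (~` A) `&` A !=set0 by exact: cl.
Qed.

Lemma cauchy_norm_cvg (X : completeNormedModType R) (u : nat -> X)
    (e : nat -> R) : e n @[n --> \oo] --> 0 ->
  (forall m n, (m <= n)%N -> `|u m - u n| <= e m) ->
  exists l : X, u n @[n --> \oo] --> l.
Proof.
move=> e0 ue.
suff /cauchy_cvg : cauchy (u n @[n --> \oo]) by move/cvg_ex.
apply/cauchy_exP => d d0.
have /cvgrPdist_lt/(_ d d0) [N _ Nd] := e0.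
exists (u N); exists N => // n /= Nn; rewrite -ball_normE/=.
apply: le_lt_trans (ue _ _ Nn) _.
have := Nd N (leqnn N); rewrite sub0r normrN; exact: le_lt_trans (ler_norm _).
Qed.

Context {X : completeNormedModType R}.

Lemma ultra_limit_functional (F : set_system X) (M : R) : UltraFilter F ->
  F [set x | `|x| <= M] -> exists2 phi : bdual X -> R^o, linear phi &
    forall f : bdual X, f x @[x --> F] --> phi f.
Proof.
move=> UF FM.
have lims (f : bdual X) : exists l : R^o, f x @[x --> F] --> l.
  apply: (@ultra_bounded_cvg _ F f (opnorm f * M)).
  apply: filterS FM => x /= xM; apply: le_trans (opnorm_le f x) _.
  by rewrite ler_wpM2l// opnorm_ge0.
have [phi phiP] := choice lims.
exists phi => // a f g.
have hR : hausdorff_space (R^o : topologicalType) by exact: Rhausdorff.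
apply: (cvg_unique hR (phiP _)).
by apply: cvgD; [apply: cvgZl_tmp; exact: phiP|exact: phiP].
Qed.

(** If [phi] could be approximated by evaluations at points of [X], these points
    would form a Cauchy sequence for the dual ball, hence for the norm, and its
    limit would represent [phi]. *)
Lemma limit_functional_far (F : set_system X) (phi : bdual X -> R^o) :
  ProperFilter F -> (forall f : bdual X, f x @[x --> F] --> phi f) ->
  (forall y, ~ forall f : {linear X -> R^o},
                 dual_ball f -> f x @[x --> F] --> f y) ->
  exists2 d : R, 0 < d &
    forall y, exists2 f : bdual X, dual_ball f & d < `|phi f - f y|.
Proof.
move=> FF phiP noy; apply: contrapT => nod.
have approx n : exists y, forall f : bdual X, dual_ball f ->
    `|phi f - f y| <= n.+1%:R^-1.
  apply: contrapT => h; apply: nod; exists n.+1%:R^-1; first by rewrite invr_gt0.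
  move=> y; apply: contrapT => h2; apply: h; exists y => f bf.
  by rewrite leNgt; apply/negP => h3; apply: h2; exists f.
have [u uP] := choice approx.
have [|m n mn|y uy] := @cauchy_norm_cvg X u (fun n => 2 * n.+1%:R^-1).
- by rewrite -(mulr0 2); apply: cvgMl_tmp; exact: cvg_harmonic.
- apply: norm_le_dual => g /[dup] /dual_ball_bdual[f fg].
  rewrite linearB /= -!fg => bg.
  have bf : dual_ball f by move=> v; rewrite /= fg; exact: bg.
  have := uP m f bf; have := uP n f bf.
  have : (n.+1%:R^-1 : R) <= m.+1%:R^-1 by rewrite lef_pV2 ?posrE// ler_nat ltnS.
  rewrite !ler_norml => h1 /andP[h2 h3] /andP[h4 h5] /=.
  have key (a b c p q : R) : q <= p -> - q <= c - b -> c - b <= q ->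
    - p <= c - a -> c - a <= p -> a - b <= 2 * p by move=> *; lra.
  exact: key h1 h2 h3 h4 h5.
apply: (noy y) => g /[dup] /dual_ball_bdual[f fg] bg.
have bf : dual_ball f by move=> v; rewrite /= fg; exact: bg.
have -> : g y = phi f.
  rewrite -fg; apply/eqP; rewrite eq_sym -subr_eq0 -normr_le0.
  apply/ler_addgt0Pr => e e0; rewrite add0r.
  have e2 : 0 < e / 2 by rewrite divr_gt0.
  near \oo => n.
  have h1 : `|phi f - f (u n)| <= e / 2.
    apply: le_trans (uP n f bf) _; apply/ltW.
    by near: n; exact: near_infty_natSinv_lt (PosNum e2).
  have h2 : `|f (u n) - f y| <= e / 2.
    rewrite -linearB; apply: le_trans (bf _) _; rewrite distrC; apply/ltW.
    by near: n; move/cvgrPdist_lt : uy; exact.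
  rewrite -(subrKA (f (u n))) (le_trans (ler_normD _ _))//; lra.
rewrite (_ : (g : X -> R^o) = f); first exact: phiP.
by apply/funext => v; rewrite fg.
Unshelve. all: by end_near. Qed.

Lemma not_weakly_compact_limit_functional (C : set X) : closed C ->
  convex_closed C -> bounded_set C -> ~ weakly_compact C ->
  exists (F : set_system X) (phi : bdual X -> R^o) (d : R),
    [/\ ProperFilter F, F C, linear phi,
        forall f : bdual X, f x @[x --> F] --> phi f
      & 0 < d /\
        forall y, exists2 f : bdual X, dual_ball f & d < `|phi f - f y|].
Proof.
move=> clC cC bC; rewrite /weakly_compact compact_ultra => nC.
have [F [UF FC nF]] : exists F : set_system X,
    [/\ UltraFilter F, F C & forall y, C y -> ~ F --> (y : weak X)].
  apply: contrapT => h; apply: nC => F UF FC; apply: contrapT => h2.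
  apply: h; exists F; split=> // y Cy Fy; apply: h2.
  by exists y.
have [M [_ MC]] := bC.
have FM : F [set x | `|x| <= M + 1].
  by apply: filterS FC => x /MC; apply; rewrite ltrDl.
have [phi phil phiP] := ultra_limit_functional UF FM.
have [|d d0 far] := limit_functional_far _ phiP.
  move=> y Fy; apply: (nF y); last exact/weak_cvgP.
  exact: (convex_closed_weak_closed _ cC clC FC Fy).
exists F, phi, d; split=> //; exact: ultra_proper.
Qed.
End limit_functional.

(** * Sequences that dominate the summing basis *)

(** Dependent choice in which each term may depend on all the previous ones. *)
Lemma history_choice (T : Type) (P : seq T -> T -> Prop) :
  (forall s, exists y, P s y) -> exists u, forall n, P (mkseq u n) (u n).
Proof.
move=> /choice[g gP].
pose h n := iter n (fun s => rcons s (g s)) [::].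
exists (fun n => g (h n)) => n.
suff -> : mkseq (fun n => g (h n)) n = h n by exact: gP.
by elim: n => // n IHn; rewrite mkseqS IHn.
Qed.

(** Keeping the total weight as a factor, instead of assuming it equal to 1,
    makes the induction on the list go through. *)
Lemma convex_closed_sum {R : realType} {X : lmodType R} (C : set X)
    (I : eqType) (s : seq I) (t : I -> R) (x : I -> X) :
  C !=set0 -> convex_closed C -> (forall i, i \in s -> C (x i)) ->
  (forall i, i \in s -> 0 <= t i) ->
  exists2 y, C y & \sum_(i <- s) t i *: x i = (\sum_(i <- s) t i) *: y.
Proof.
move=> [y0 Cy0] cC; elim: s => [|i s IHs] sC st.
  by exists y0 => //; rewrite !big_nil scale0r.
have [||y Cy yE] := IHs.
- by move=> j js; apply: sC; rewrite inE js orbT.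
- by move=> j js; apply: st; rewrite inE js orbT.
have Cx : C (x i) by apply: sC; rewrite mem_head.
have ti : 0 <= t i by apply: st; rewrite mem_head.
have T0 : 0 <= \sum_(j <- s) t j.
  by rewrite big_seq sumr_ge0// => j js; apply: st; rewrite inE js orbT.
rewrite !big_cons yE; set T := \sum_(j <- s) t j in T0 *.
have [tT|tT] := eqVneq (t i + T) 0.
  have -> : t i = 0 by lra.
  have -> : T = 0 by lra.
  by exists y; rewrite // addr0 !scale0r addr0.
have tTp : 0 < t i + T by rewrite lt_neqAle eq_sym tT addr_ge0.
exists (t i / (t i + T) *: x i + (1 - t i / (t i + T)) *: y).
  apply: cC => //; rewrite divr_ge0 ?(ltW tTp)//= ler_pdivrMr// mul1r.
  by rewrite lerDl.
rewrite scalerDr !scalerA; congr (_ *: _ + _ *: _); first by field.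
by field.
Qed.

Section blocks.
Context (F : nat -> {fset nat}) (F0 : forall n, F n != fset0)
  (Flt : forall n i j, i \in F n -> j \in F n.+1 -> (i < j)%N).

Lemma blocks_lt m n i j :
  (m < n)%N -> i \in F m -> j \in F n -> (i < j)%N.
Proof.
elim: n j => // n IHn j; rewrite ltnS leq_eqVlt => /predU1P[<-|mn] iF jF.
  exact: Flt iF jF.
have /fset0Pn[k kF] := F0 n.
exact: ltn_trans (IHn _ mn iF kF) (Flt kF jF).
Qed.

Lemma blocks_ge n i : i \in F n -> (n <= i)%N.
Proof.
elim: n i => // n IHn i iF; have /fset0Pn[k kF] := F0 n.
exact: leq_ltn_trans (IHn _ kF) (Flt kF iF).
Qed.

Lemma blocks_min n : exists2 m, m \in F n & forall i, i \in F n -> (m <= i)%N.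
Proof.
have Fn : exists i, i \in F n by have /fset0Pn := F0 n.
by exists (ex_minn Fn); case: ex_minnP.
Qed.
End blocks.

Section james.
Context {R : realType} {X : normedModType R}.
Implicit Types (x w : nat -> X) (c : R).

(** James's condition for weak non-compactness.  The error terms add up to at
    most [c / 4], small enough to be absorbed in [james_coefficient_le], and they
    decrease with [k], which makes the condition pass to convex blocks. *)
Definition james_sequence c x := 0 < c /\
  exists f : nat -> {linear X -> R^o}, forall n,
    [/\ dual_ball (f n), forall k, (k < n)%N -> f n (x k) = 0
      & forall k, (n <= k)%N -> `|f n (x k) - c| <= c / 2 ^+ (k + 3)].

Lemma convex_block_in (C : set X) x w : convex_closed C ->
  (forall n, C (x n)) -> convex_block_sequence x w -> forall n, C (w n).
Proof.
move=> cC Cx [F [lam [F0 Flt lam01 lam1 wE]]] n; rewrite wE.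
have [||||y Cy ->] := @convex_closed_sum _ _ C _ (F n) (lam n) x.
- by exists (x 0).
- by [].
- by [].
- by move=> i /lam01/andP[].
by rewrite lam1 scale1r.
Qed.

Lemma convex_block_of_subsequence x y :
  subsequence x y -> convex_block_sequence x y.
Proof.
move=> [k kinc ->]; exists (fun n => [fset k n]%fset), (fun _ _ => 1); split.
- by move=> n; apply/fset0Pn; exists (k n); rewrite inE.
- by move=> n i j; rewrite !inE => /eqP -> /eqP ->; exact: kinc.
- by move=> *; rewrite ler01 lexx.
- by move=> n; rewrite big_seq_fset1.
- by move=> n; rewrite big_seq_fset1 scale1r.
Qed.

(** The functional for the [n]-th block is the one attached to its least index:
    it vanishes on the earlier blocks and averages its values on the others. *)
Lemma james_convex_block c x w :
  james_sequence c x -> convex_block_sequence x w -> james_sequence c w.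
Proof.
move=> [c0 [f fP]] [F [lam [F0 Flt lam01 lam1 wE]]]; split=> //.
have /choice[g gP] n : exists m, m \in F n /\
    forall i, i \in F n -> (m <= i)%N.
  by have [m] := blocks_min F0 n; exists m.
exists (f \o g) => n /=; have [bf f0 fc] := fP (g n); split=> // k kn.
  rewrite wE linear_sum big_seq big1// => i iF.
  by rewrite linearZ /= f0 ?scaler0//; exact: (blocks_lt F0 Flt kn iF (gP n).1).
have -> : c = \sum_(i <- F k) lam k i * c by rewrite -mulr_suml lam1 mul1r.
rewrite wE linear_sum /= -sumrB.
apply: (@le_trans _ _ (\sum_(i <- F k) lam k i * (c / 2 ^+ (k + 3)))); last first.
  by rewrite -mulr_suml lam1 mul1r -mulr_suml lam1 mul1r.
apply: le_trans (ler_norm_sum _ _ _) _.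
rewrite big_seq [leRHS]big_seq; apply: ler_sum => i iF.
have /andP[l0 _] := lam01 k i iF.
have ki : (k <= i)%N by exact: blocks_ge iF.
have gi : (g n <= i)%N.
  move: kn; rewrite leq_eqVlt => /predU1P[nk|nk].
    by apply: (gP n).2; rewrite nk.
  exact: ltnW (blocks_lt F0 Flt nk (gP n).1 iF).
rewrite linearZ /= -mulrBr normrM ger0_norm// ler_wpM2l//.
apply: le_trans (fc i gi) _.
rewrite ler_pM2l// lef_pV2 ?posrE ?exprn_gt0//.
by rewrite ler_eXn2l ?leq_add2r// ltr1n.
Qed.

Lemma tail_geometric_le (m n : nat) :
  \sum_(m <= k < n) (2 ^+ (k + 3))^-1 <= 4^-1 :> R.
Proof.
have h : \sum_(0 <= k < n) (2 ^+ (k + 3))^-1 = 4^-1 - (2 ^+ (n + 2))^-1 :> R.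
  elim: n => [|n IHn]; first by rewrite big_nil; lra.
  rewrite big_nat_recr//= IHn -!exprVn !exprD !exprS !expr0.
  by set z := _ ^+ n; lra.
have p k : 0 <= (2 ^+ k)^-1 :> R by rewrite invr_ge0 exprn_ge0.
have [nm|mn] := leqP n m.
  by rewrite big_geq// invr_ge0.
apply: (@le_trans _ _ (\sum_(0 <= k < n) (2 ^+ (k + 3))^-1)).
  by rewrite (big_cat_nat (leq0n m) (ltnW mn))/= lerDr sumr_ge0.
by rewrite h lerBlDr lerDl.
Qed.

(** Evaluating [f m] on [\sum a_k x_k] gives, up to errors controlled by the
    largest tail sum, [c] times the tail sum from [m] on; choosing [m] with the
    largest tail sum absorbs the errors. *)
Lemma james_coefficient_le c x (n : nat) (a : nat -> R) (i : nat) :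
  james_sequence c x -> (i < n)%N ->
  `|a i| <= 4 / c * `|\sum_(0 <= k < n) a k *: x k|.
Proof.
move=> [c0 [f fP]] ni.
set v := \sum_(0 <= k < n) _.
pose S m := \sum_(m <= k < n) a k.
have [m mn mS] : exists2 m, (m <= n)%N & forall k, (k <= n)%N -> `|S k| <= `|S m|.
  elim: (n) => [|p [m mp mS]].
    by exists 0 => // k; rewrite leqn0 => /eqP ->.
  have [h|h] := leP `|S p.+1| `|S m|.
    exists m; first exact: leqW.
    by move=> k; rewrite leq_eqVlt => /predU1P[->//|]; rewrite ltnS; exact: mS.
  exists p.+1 => // k; rewrite leq_eqVlt => /predU1P[->//|].
  by rewrite ltnS => /mS kS; apply: le_trans kS (ltW h).
have aS k : (k < n)%N -> `|a k| <= 2 * `|S m|.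
  move=> kn; have -> : a k = S k - S k.+1.
    by rewrite /S (big_ltn kn) addrK.
  rewrite mulr2n mulrDl !mul1r (le_trans (ler_normB _ _))//.
  by rewrite lerD// mS// ltnW.
have [bf f0 fc] := fP m.
have fv : f m v = c * S m + \sum_(m <= k < n) a k * (f m (x k) - c).
  rewrite /v linear_sum (big_cat_nat (leq0n m) mn)/=.
  rewrite big_nat_cond big1 ?add0r; last first.
    by move=> k /andP[/andP[_ km] _]; rewrite linearZ /= f0// scaler0.
  rewrite /S mulr_sumr -big_split/=; apply: eq_bigr => k _.
  by rewrite linearZ /= mulrBr (mulrC c) addrC subrK.
have err : `|\sum_(m <= k < n) a k * (f m (x k) - c)| <= 2 * `|S m| * (c / 4).
  apply: le_trans (ler_norm_sum _ _ _) _.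
  apply: (@le_trans _ _ (\sum_(m <= k < n) 2 * `|S m| * (c / 2 ^+ (k + 3)))).
    rewrite big_nat_cond [leRHS]big_nat_cond; apply: ler_sum.
    move=> k /andP[/andP[mk kn] _]; rewrite normrM.
    by rewrite ler_pM// ?aS ?fc.
  rewrite -mulr_sumr -mulr_sumr ler_wpM2l ?mulr_ge0//.
  by rewrite ler_pM2l// tail_geometric_le.
have cS : c * `|S m| <= `|v| + 2 * `|S m| * (c / 4).
  have <- : `|c * S m| = c * `|S m| by rewrite normrM gtr0_norm.
  have -> : c * S m = f m v - \sum_(m <= k < n) a k * (f m (x k) - c).
    by rewrite fv addrK.
  by apply: le_trans (ler_normB _ _) _; rewrite lerD.
apply: le_trans (aS i ni) _.
rewrite mulrAC ler_pdivlMr//.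
by rewrite mulrC; lra.
Qed.
End james.

(** Helly's lemma chooses [f n] killing the points already chosen, with
    [phi (f n) = c]; then [x n] is taken in [C], close to [phi] on the finitely
    many functionals chosen so far. *)
Lemma james_sequence_exists {R : realType} {X : completeNormedModType R}
    (C : set X) : closed C -> convex_closed C -> bounded_set C ->
  ~ weakly_compact C ->
  exists (c : R) (x : nat -> X), james_sequence c x /\ forall n, C (x n).
Proof.
move=> clC cC bC nC.
have [F [phi [c [FF FC phil phiP [c0 far]]]]] :=
  not_weakly_compact_limit_functional clC cC bC nC.
pose P (s : seq (bdual X * X)) (y : bdual X * X) :=
  [/\ dual_ball y.1, phi y.1 = c, C y.2, forall z, z \in s -> y.1 z.2 = 0
    & forall z, z \in y :: s -> phi z.1 = c ->
        `|z.1 y.2 - c| <= c / 2 ^+ (size s + 3)].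
have [|u uP] := @history_choice _ P.
  move=> s.
  have [f [bf fs fc]] := helly (map snd s) phil c0 far.
  pose e : R := c / 2 ^+ (size s + 3).
  have e0 : 0 < e by rewrite divr_gt0// exprn_gt0.
  have Fs : F [set x | forall z, z \in (f, x) :: s -> phi z.1 = c ->
                         `|z.1 x - c| <= e].
    have near1 (g : bdual X) : F [set x | phi g = c -> `|g x - c| <= e].
      have /cvgrPdist_le/(_ e e0) := phiP g.
      by apply: filterS => x + <-; rewrite distrC.
    have nears : F [set x | forall z, z \in s -> phi z.1 = c ->
                              `|z.1 x - c| <= e].
      elim: s {fs e e0 f bf fc} (e) near1 => [e|z s IHs e] near1.
        by apply: filterS filterT => x _ z.
      apply: filterS2 (near1 z.1) (IHs e near1) => x h1 h2 z'.
      by rewrite inE => /predU1P[->|/h2].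
    apply: filterS2 (near1 f) nears => x h1 h2 z'.
    by rewrite inE => /predU1P[->|/h2].
  have [x [Cx xs]] := filter_ex (filterI FC Fs).
  exists (f, x); split=> // z zs.
  by apply: fs; apply: map_f.
exists c, (fun n => (u n).2); split; last by move=> n; case: (uP n).
split=> //; exists (fun n => (u n).1 : {linear X -> R^o}) => n.
have um k n' : (k < n')%N -> u k \in mkseq u n'.
  by move=> kn; apply: map_f; rewrite mem_iota.
have [b fc _ f0 _] := uP n; split=> // k kn; first exact: f0 (um _ _ kn).
have [_ _ _ _] := uP k; rewrite size_mkseq; apply=> //.
move: kn; rewrite leq_eqVlt => /predU1P[->|kn]; first exact: mem_head.
by rewrite inE um ?orbT.
Qed.

(** * Rosenthal's dichotomy *)

Section dichotomy.
Context {W : Type} (U : set_system nat) {UF : UltraFilter U}.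
Implicit Types (A B : nat -> set W) (E : set W) (m : nat -> nat).

(** [E] is thin when a well-founded strategy empties it: at each stage intersect
    with [A n] (or with [B n]) for an arbitrary [n] in some set of the
    ultrafilter.  Both alternatives of the dichotomy come from this notion: the
    ultrafilter decides, so a set that is not thin remains so after intersection
    with [A n] and with [B n], for almost all [n]. *)
Inductive thin A B : set W -> Prop :=
| thin0 E : E = set0 -> thin A B E
| thinA E (M : set nat) : U M ->
    (forall n, M n -> thin A B (E `&` A n)) -> thin A B E
| thinB E (M : set nat) : U M ->
    (forall n, M n -> thin A B (E `&` B n)) -> thin A B E.

Lemma filter_all (T : Type) (s : seq T) (V : T -> set nat) :
  (forall i, U (V i)) -> U [set n | all (fun i => `[< V i n >]) s].
Proof.
move=> UV; elim: s => [|i s IHs] /=; first exact: filterS filterT.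
by apply: filterS2 (UV i) IHs => n Vn sn; rewrite /= sn andbT; exact/asboolP.
Qed.

(** Follow the strategy along a sequence [m] that eventually obeys the
    prescriptions [V].  A point [w] of [E] lying in infinitely many [A (m j)] and
    infinitely many [B (m j)] could survive every stage, although the strategy
    ends with the empty set. *)
Lemma thin_avoids A B E : thin A B E ->
  exists V : seq nat -> set nat, (forall s, U (V s)) /\
    forall m (N : nat), (forall j, (N <= j)%N -> V (mkseq m j) (m j)) ->
    forall w, E w ->
    ~ ((forall i, exists2 j, (i <= j)%N & A (m j) w) /\
       (forall i, exists2 j, (i <= j)%N & B (m j) w)).
Proof.
have step (D : nat -> set W) E' (M : set nat) : U M ->
    (forall n, M n -> exists V : seq nat -> set nat, (forall s, U (V s)) /\
      forall m (N : nat), (forall j, (N <= j)%N -> V (mkseq m j) (m j)) ->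
      forall w, (E' `&` D n) w ->
      ~ ((forall i, exists2 j, (i <= j)%N & A (m j) w) /\
         (forall i, exists2 j, (i <= j)%N & B (m j) w))) ->
    exists V : seq nat -> set nat, (forall s, U (V s)) /\
      forall m (N : nat), (forall j, (N <= j)%N -> V (mkseq m j) (m j)) ->
      forall w, E' w -> (forall i, exists2 j, (i <= j)%N & D (m j) w) ->
      ~ ((forall i, exists2 j, (i <= j)%N & A (m j) w) /\
         (forall i, exists2 j, (i <= j)%N & B (m j) w)).
  move=> UM MV.
  have /choice[V VP] : forall n, exists V : seq nat -> set nat,
      (forall s, U (V s)) /\ (M n ->
      forall m (N : nat), (forall j, (N <= j)%N -> V (mkseq m j) (m j)) ->
      forall w, (E' `&` D n) w ->
      ~ ((forall i, exists2 j, (i <= j)%N & A (m j) w) /\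
         (forall i, exists2 j, (i <= j)%N & B (m j) w))).
    move=> n; have [/MV[V [VU VP]]|nM] := pselect (M n); first by exists V.
    by exists (fun=> setT); split=> // s; exact: filterT.
  exists (fun s => M `&` [set n | all (fun i => `[< V i s n >]) s]); split.
    move=> s; apply: filterI => //.
    by apply: (@filter_all _ _ (fun i => V i s)) => i; have [] := VP i.
  move=> m N mV w Sw Dw; have [j Nj Dj] := Dw N.
  have [Mj _] := mV j Nj; have [_ /(_ Mj)/(_ m j.+1)] := VP (m j).
  apply=> // i ji; have [_ /allP/= h] := mV i (leq_trans Nj (ltnW ji)).
  by apply/asboolP; apply: h; apply: map_f; rewrite mem_iota.
elim=> [{}E ->|{}E M UM _ IH|{}E M UM _ IH].
- by exists (fun=> setT); split=> // s; exact: filterT.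
- have [V [VU VP]] := step A E M UM IH.
  by exists V; split=> // m N mV w Sw h; apply: VP mV w Sw h.1 h.
- have [V [VU VP]] := step B E M UM IH.
  by exists V; split=> // m N mV w Sw h; apply: VP mV w Sw h.2 h.
Qed.

Definition cells A B (s : seq nat) : seq (set W) :=
  foldl (fun L n => [seq E `&` A n | E <- L] ++ [seq E `&` B n | E <- L])
    [:: setT] s.

Context (Uoo : forall N, U [set n | (N <= n)%N]).

(** Choose [m] so that all the cells stay thick, that is, not thin: each step has
    only finitely many cells to preserve.  Thick cells are nonempty. *)
Lemma not_thin_independent A B : ~ thin A B setT ->
  exists2 m, {homo m : i j / (i < j)%N} &
    forall (N : nat) (b : nat -> bool), exists w : W,
      forall j, (j < N)%N -> if b j then A (m j) w else B (m j) w.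
Proof.
move=> nthin.
pose thick := [pred E | `[< ~ thin A B E >]].
have thickA E : ~ thin A B E -> U [set n | ~ thin A B (E `&` A n)].
  move=> nE; have [h|//] := in_ultra_setVsetC [set n | thin A B (E `&` A n)] UF.
  by case: nE; exact: thinA h _.
have thickB E : ~ thin A B E -> U [set n | ~ thin A B (E `&` B n)].
  move=> nE; have [h|//] := in_ultra_setVsetC [set n | thin A B (E `&` B n)] UF.
  by case: nE; exact: thinB h _.
pose P s n := all thick (cells A B s) ->
  all thick (cells A B (rcons s n)) /\ forall k, k \in s -> (k < n)%N.
have [|m mP] := @history_choice _ P.
  move=> s; rewrite /P; have [sthick|] := boolP (all thick _); last by exists 0.
  have h1 : U [set n | forall k, k \in s -> (k < n)%N].
    apply: filterS (Uoo (\max_(k <- s) k).+1) => n /= sn k ks.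
    by apply: leq_ltn_trans sn; exact: leq_bigmax_seq.
  have h2 : U [set n | all thick (cells A B (rcons s n))].
    rewrite /cells; under eq_set do rewrite -cats1 foldl_cat /=.
    rewrite -/(cells A B s).
    elim: (cells A B s) sthick => [|E L IHL] /=.
      by move=> _; exact: filterS filterT.
    move=> /andP[/asboolP nE /IHL UL].
    apply: filterS3 (thickA E nE) (thickB E nE) UL.
    move=> n hA hB; rewrite /= !all_cat /= => /andP[-> ->].
    by rewrite !andbT; apply/andP; split; exact/asboolP.
  by have [n []] := filter_ex (filterI h1 h2); exists n.
have mthick n : all thick (cells A B (mkseq m n)).
  elim: n => [|n IHn]; first by rewrite /= andbT; exact/asboolP.
  by rewrite mkseqS; case: (mP n IHn).
exists m => [i j ij|N b].
  by have [_] := mP j (mthick j); apply; apply: map_f; rewrite mem_iota.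
have : has (fun E => `[< forall w, E w ->
    forall j, (j < N)%N -> if b j then A (m j) w else B (m j) w >])
    (cells A B (mkseq m N)).
  elim: N => [|N IHN]; first by rewrite /= orbF; exact/asboolP.
  rewrite mkseqS /cells -cats1 foldl_cat /= -/(cells A B _) has_cat !has_map.
  elim: (cells _ _ _) IHN => //= E L IHL /orP[/asboolP SN|/IHL/orP[->|->]];
    rewrite ?orbT//.
  case bN : (b N); [apply/orP; left|apply/orP; right];
    apply/orP; left; apply/asboolP => w /= [Sw Dw] j;
    rewrite ltnS leq_eqVlt => /predU1P[->|/(SN w Sw)//]; by rewrite bN.
have := mthick N; elim: (cells _ _ _) => //= E L IHL /andP[/asboolP nE LT].
case/orP=> [/asboolP Sb|/(IHL LT)//].
have [w Sw] : E !=set0.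
  by apply/set0P/negP => /eqP S0; apply: nE; exact: thin0.
by exists w; exact: Sb.
Qed.

(** If every pair is thin, a single sequence can obey all the prescriptions from
    [thin_avoids]: the [j]-th term obeys those of the pairs of index at most [j],
    so the prescriptions of each pair are obeyed from some point on. *)
Lemma independent_or_nonoscillating (A B : nat -> nat -> set W) :
  exists2 m : nat -> nat, {homo m : i j / (i < j)%N} &
    (exists k, forall (N : nat) (b : nat -> bool), exists w : W,
       forall j, (j < N)%N -> if b j then A k (m j) w else B k (m j) w) \/
    (forall k w, ~ ((forall i, exists2 j, (i <= j)%N & A k (m j) w) /\
                    (forall i, exists2 j, (i <= j)%N & B k (m j) w))).
Proof.
have [[k nk]|allthin] := pselect (exists k, ~ thin (A k) (B k) setT).
  by have [m mi mP] := not_thin_independent nk; exists m => //; left; exists k.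
have /choice[V VP] : forall k, exists V : seq nat -> set nat,
    (forall s, U (V s)) /\
    forall m (N : nat), (forall j, (N <= j)%N -> V (mkseq m j) (m j)) ->
    forall w, ~ ((forall i, exists2 j, (i <= j)%N & A k (m j) w) /\
                 (forall i, exists2 j, (i <= j)%N & B k (m j) w)).
  move=> k; have /thin_avoids[V [VU VP]] : thin (A k) (B k) setT.
    by apply: contrapT => nk; apply: allthin; exists k.
  by exists V; split=> // m N mV w; exact: VP mV w I.
pose P s n := (forall i, i \in s -> (i < n)%N) /\
  (forall k, (k <= size s)%N -> V k s n).
have [|m mP] := @history_choice _ P.
  move=> s.
  have h1 : U [set n | forall k, k \in s -> (k < n)%N].
    apply: filterS (Uoo (\max_(k <- s) k).+1) => n /= sn k ks.
    by apply: leq_ltn_trans sn; exact: leq_bigmax_seq.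
  have h2 : U [set n | all (fun k => `[< V k s n >]) (iota 0 (size s).+1)].
    by apply: (@filter_all _ _ (fun k => V k s)) => k; have [] := VP k.
  have [n [n1 /allP n2]] := filter_ex (filterI h1 h2); exists n; split=> // k ks.
  by apply/asboolP; apply: n2; rewrite mem_iota.
exists m => [i j ij|].
  by have [h _] := mP j; apply: h; apply: map_f; rewrite mem_iota.
right=> k; have [_ kP] := VP k; apply: (kP m k) => j kj.
by have [_] := mP j; apply; rewrite size_mkseq.
Qed.
End dichotomy.

Section rosenthal.
Context {R : realType}.

(** The limit along the ultrafilter is approached infinitely often; were another
    value approached infinitely often, two rationals in between would witness an
    oscillation. *)
Lemma nonoscillating_cvg (U : set_system nat) (u : nat -> R) (M : R) :
  UltraFilter U -> (forall N, U [set n | (N <= n)%N]) ->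
  (forall n, `|u n| <= M) ->
  (forall r s : rat, (r < s)%R ->
     ~ ((forall i, exists2 j, (i <= j)%N & ratr s < u j) /\
        (forall i, exists2 j, (i <= j)%N & u j < ratr r))) ->
  exists l : R, u n @[n --> \oo] --> l.
Proof.
move=> UU Uoo uM osc.
have [|l ul] := @ultra_bounded_cvg R _ U u M UU.
  by apply: filterS filterT => n _; exact: uM.
exists l.
have lnear (e : R) : 0 < e -> forall i, exists2 j, (i <= j)%N & `|l - u j| < e.
  move=> e0 i; have /cvgrPdist_lt/(_ e e0) Ue := ul.
  by have [j [ij je]] := filter_ex (filterI (Uoo i) Ue); exists j.
have eventually_not (P : nat -> Prop) :
    ~ (forall i, exists2 j, (i <= j)%N & P j) -> \forall n \near \oo, ~ P n.
  move=> nP; apply: contrapT => h; apply: nP => i; apply: contrapT => h2.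
  by apply: h; exists i => // j /= ij Pj; apply: h2; exists j.
apply/cvgrPdist_le => e e0.
have up : \forall n \near \oo, ~ (l + e < u n).
  have [r /[!in_itv]/= /andP[lr re]] : exists r, ratr r \in `]l, (l + e)[.
    by apply: rat_in_itvoo; rewrite ltrDl.
  have [s /[!in_itv]/= /andP[rs se]] := rat_in_itvoo re.
  apply: eventually_not => h; apply: (osc r s); first by rewrite -(ltr_rat R).
  split=> i.
    by have [j ij uj] := h i; exists j => //; exact: lt_trans uj.
  have [|j ij uj] := lnear (ratr r - l) _ i; first by rewrite subr_gt0.
  exists j => //; have := ler_norm (u j - l); rewrite distrC => h2.
  by have := le_lt_trans h2 uj; rewrite ltrD2r.
have dn : \forall n \near \oo, ~ (u n < l - e).
  have [s /[!in_itv]/= /andP[es sl]] : exists s, ratr s \in `](l - e), l[.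
    by apply: rat_in_itvoo; rewrite ltrBlDr ltrDl.
  have [r /[!in_itv]/= /andP[er rs]] := rat_in_itvoo es.
  apply: eventually_not => h; apply: (osc r s); first by rewrite -(ltr_rat R).
  split=> i; last first.
    by have [j ij uj] := h i; exists j => //; exact: lt_trans er.
  have [|j ij uj] := lnear (l - ratr s) _ i; first by rewrite subr_gt0.
  exists j => //; have := le_lt_trans (ler_norm _) uj.
  by rewrite ltrD2l ltrN2.
apply: filterS2 up dn => n /negP; rewrite -leNgt => h1 /negP; rewrite -leNgt => h2.
by rewrite ler_norml; lra.
Qed.

Context {X : normedModType R}.

(** Functionals [f], [g] of the dual ball that are above [s] on the nonnegative
    coefficients and below [r] on the others, and conversely, differ by at least
    [s - r] times the sum of absolute values. *)
Lemma independent_l1 (x : nat -> X) (r s : R) :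
  (forall (N : nat) (b : nat -> bool), exists f : {linear X -> R^o},
    dual_ball f /\ forall j, (j < N)%N -> if b j then s < f (x j) else f (x j) < r) ->
  forall n a, (s - r) / 2 * \sum_(0 <= i < n) `|a i|
    <= `|\sum_(0 <= i < n) a i *: x i|.
Proof.
move=> ind n a.
have [f [bf fP]] := ind n (fun i => 0 <= a i).
have [g [bg gP]] := ind n (fun i => a i < 0).
set v := \sum_(0 <= i < n) _ *: _.
have h : (s - r) * \sum_(0 <= i < n) `|a i| <= f v - g v.
  have sumE (h : {linear X -> R^o}) : h v = \sum_(0 <= i < n) a i * h (x i) :> R.
    by rewrite /v linear_sum; apply: eq_bigr => i _; rewrite linearZ.
  rewrite !sumE -sumrB mulr_sumr.
  rewrite big_nat_cond [leRHS]big_nat_cond; apply: ler_sum => i.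
  rewrite andbT => /andP[_ ni].
  rewrite -mulrBr.
  have := fP i ni; have := gP i ni.
  move: (f (x i) : R) (g (x i) : R) => p q.
  have [a0|a0] := ltP (a i) 0.
    move=> h1 h2; rewrite ltr0_norm// mulrC !mulNr -mulrN ler_nM2l//; lra.
  move=> h1 h2; rewrite ger0_norm// mulrC ler_wpM2l//; lra.
have := bf v; have := bg v; rewrite !ler_norml => /andP[g1 g2] /andP[f1 f2].
rewrite mulrAC ler_pdivrMr//.
have key (p q t w : R) : w <= p - q -> - t <= q -> p <= t -> w <= t * 2.
  by move=> *; lra.
exact: key h g1 f2.
Qed.

Lemma weak_cauchy_of_dual_ball (x : nat -> X) :
  (forall f, dual_ball f -> exists l : R^o, f (x n) @[n --> \oo] --> l) ->
  weak_cauchy x.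
Proof.
move=> xl [f cf] /=; have [g bg [k k0 fg]] := continuous_dual_ball cf.
have [l gl] := xl g bg.
have fl : f (x n) @[n --> \oo] --> (k * l : R^o).
  rewrite (_ : (fun n => f (x n)) = (fun n => k *: (g (x n) : R^o))).
    exact: cvgZl_tmp.
  by apply/funext => n; rewrite fg.
apply: cvg_cauchy; apply/cvg_ex; by exists (k * l).
Qed.

(** Apply the dichotomy for sets to the functionals [f] of the dual ball, with
    [f (x n)] above or below two rationals. *)
Lemma rosenthal_dichotomy (x : nat -> X) (M : R) : (forall n, `|x n| <= M) ->
  exists2 m : nat -> nat, {homo m : i j / (i < j)%N} &
    weak_cauchy (x \o m) \/
    exists2 d : R, 0 < d & forall n a,
      d * \sum_(0 <= i < n) `|a i| <= `|\sum_(0 <= i < n) a i *: x (m i)|.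
Proof.
move=> xM.
have [U [UU Uoo]] := ultraFilterLemma eventually_filter.
have {}Uoo N : U [set n | (N <= n)%N].
  by apply: Uoo; exists N.
have [rs rsP] : exists rs : nat -> rat * rat, forall p, exists k, rs k = p.
  exists (fun k => odflt (0, 0) (choice.unpickle k)) => p.
  by exists (choice.pickle p); rewrite choice.pickleK.
(* The middle condition makes the pairs of rationals in the wrong order
   harmless: their [A] is empty. *)
pose A k n := [set f : {linear X -> R^o} | dual_ball f /\
  (rs k).1 < (rs k).2 /\ ratr (rs k).2 < f (x n)].
pose B k n := [set f : {linear X -> R^o} | dual_ball f /\
  f (x n) < ratr (rs k).1].
have [m mi [[k kP]|mP]] := independent_or_nonoscillating Uoo A B; exists m => //.
  right; have [f /(_ 0 isT) [_ [rs12 _]]] := kP 1 (fun=> true).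
  exists ((ratr (rs k).2 - ratr (rs k).1) / 2).
    by rewrite divr_gt0// subr_gt0 ltr_rat.
  (* The extra index [N], put on the side of [B], provides a functional of the
     dual ball even when [N] is 0. *)
  apply: independent_l1 => N b; have [g gP] := kP N.+1 (fun i => (i < N)%N && b i).
  exists g; split.
    by have := gP N (ltnSn N); rewrite ltnn /= => -[].
  move=> j jN; have := gP j (ltnW jN); rewrite jN /=.
  by case: (b j) => -[_] // [].
left; apply: weak_cauchy_of_dual_ball => f bf.
apply: (@nonoscillating_cvg U (fun n => f (x (m n))) M) => //.
  by move=> n; exact: le_trans (bf _) (xM _).
move=> r s rs12 [h1 h2]; have [k rsE] := rsP (r, s); apply: (mP k f).
split=> i.
  by have [j ij fj] := h1 i; exists j => //; rewrite /A /= rsE.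
by have [j ij fj] := h2 i; exists j => //; rewrite /B /= rsE.
Qed.
End rosenthal.

(** * Convex combinations as polynomials *)

Section psum.
Context {R : realType} {X : normedModType R}.
Implicit Types (u x : nat -> X) (q r : {poly R}).

(** Finitely supported scalar sequences are encoded as polynomials, so that
    shifting a sequence is multiplication by a power of ['X]. *)
Definition psum u q : X := \sum_(0 <= i < size q) q`_i *: u i.

Lemma psum_widen u q (n : nat) : (size q <= n)%N ->
  psum u q = \sum_(0 <= i < n) q`_i *: u i.
Proof.
move=> qn; rewrite /psum (big_cat_nat (leq0n _) qn)/= [X in _ + X]big_nat_cond.
rewrite [X in _ + X]big1 ?addr0// => i /andP[/andP[qi _] _].
by rewrite nth_default// scale0r.
Qed.

Lemma psumP u t q r : psum u (t *: q + r) = t *: psum u q + psum u r.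
Proof.
pose n := maxn (size (t *: q + r)) (maxn (size q) (size r)).
rewrite (@psum_widen u _ n) ?leq_maxl//.
rewrite (@psum_widen u q n) ?(leq_trans (leq_maxl _ _) (leq_maxr _ _))//.
rewrite (@psum_widen u r n) ?(leq_trans (leq_maxr _ _) (leq_maxr _ _))//.
rewrite scaler_sumr -big_split/=; apply: eq_bigr => i _.
by rewrite coefD coefZ scalerDl scalerA.
Qed.

HB.instance Definition _ u :=
  GRing.isLinear.Build R {poly R} X *:%R (psum u) (fun t q r => psumP u t q r).

Lemma psumXn u (n : nat) : psum u 'X^n = u n.
Proof.
rewrite /psum size_polyXn big_nat_recr//= coefXn eqxx scale1r.
rewrite big_nat_cond big1 ?add0r// => i /andP[/andP[_ ni] _].
by rewrite coefXn ltn_eqF// scale0r.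
Qed.

Lemma psum_shift u (p : nat) q :
  psum u ('X^p * q) = psum (fun n => u (n + p)%N) q.
Proof.
rewrite (@psum_widen u _ (p + size q)); last first.
  by apply: leq_trans (size_polyMleq _ _) _; rewrite size_polyXn addSn.
rewrite (big_cat_nat (leq0n p) (leq_addr _ _))/=.
rewrite big_nat_cond big1 ?add0r; last first.
  by move=> i /andP[/andP[_ ip] _]; rewrite coefXnM ip scale0r.
rewrite -{1}(add0n p) big_addn addKn /psum; apply: eq_bigr => i _.
by rewrite coefXnM ltnNge leq_addl /= addnK.
Qed.

Definition probability_poly : set {poly R} :=
  [set q : {poly R} | (forall i, 0 <= q`_i) /\ q.[1] = 1].

Lemma horner1_widen q (n : nat) : (size q <= n)%N ->
  q.[1] = \sum_(0 <= i < n) q`_i.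
Proof.
move=> qn; rewrite (horner_coef_wide _ qn) big_mkord.
by apply: eq_bigr => i _; rewrite expr1n mulr1.
Qed.

Lemma probability_poly_convex : convex_closed probability_poly.
Proof.
move=> q r t [q0 q1] [r0 r1] /andP[t0 t1]; split=> [i|].
  by rewrite coefD !coefZ addr_ge0// mulr_ge0// subr_ge0.
by rewrite hornerD !hornerZ q1 r1 !mulr1 addrC subrK.
Qed.

Lemma probability_polyXn (n : nat) : probability_poly 'X^n.
Proof.
by split=> [i|]; [rewrite coefXn; case: eqP|rewrite hornerXn expr1n].
Qed.

Lemma probability_polyM (p : nat) q :
  probability_poly q -> probability_poly ('X^p * q).
Proof.
move=> [q0 q1]; split=> [i|]; first by rewrite coefXnM; case: ifP.
by rewrite hornerM hornerXn expr1n q1 mulr1.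
Qed.

Lemma closure_normP (K : set X) (v : X) :
  closure K v <-> forall e, 0 < e -> exists2 y, K y & `|v - y| < e.
Proof.
split=> [Kv e e0|Kv B /nbhs_ballP[e /= e0 eB]].
  by have [y []] := Kv _ (nbhsx_ballx v e e0); rewrite -ball_normE; exists y.
by have [y Ky vy] := Kv e e0; exists y; split=> //; apply: eB; rewrite -ball_normE.
Qed.

Lemma closure_convex (K : set X) : convex_closed K -> convex_closed (closure K).
Proof.
move=> cK x y t /closure_normP Kx /closure_normP Ky /andP[t0 t1].
apply/closure_normP => e e0.
have [x' Kx' xx'] := Kx e e0; have [y' Ky' yy'] := Ky e e0.
exists (t *: x' + (1 - t) *: y'); first by apply: cK => //; rewrite t0.
rewrite opprD addrACA -!scalerBr (le_lt_trans (ler_normD _ _))//.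
rewrite !normrZ !ger0_norm ?subr_ge0//.
have [h|h] := eqVneq t 0; first by rewrite h mul0r add0r subr0 mul1r.
have tp : 0 < t by rewrite lt_neqAle eq_sym h.
have -> : e = t * e + (1 - t) * e by rewrite mulrBl mul1r addrC subrK.
rewrite ltr_leD ?ltr_pM2l// ler_wpM2l ?subr_ge0//; exact: ltW.
Qed.

Definition tail_polys (N : nat) : set {poly R} :=
  [set q | probability_poly q /\ forall i, (i < N)%N -> q`_i = 0].

(** Mazur's lemma: the closed convex hull of each tail of [x] is weakly closed,
    hence contains [l]. *)
Lemma mazur_tail x l : (forall f, dual_ball f -> f (x n) @[n --> \oo] --> f l) ->
  forall (N : nat) e, 0 < e -> exists2 q, tail_polys N q & `|l - psum x q| < e.
Proof.
move=> xl N e e0.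
pose K := psum x @` tail_polys N.
suff /closure_normP/(_ e e0)[_ [q Nq <-] h] : closure K l by exists q.
apply: (@convex_closed_weak_closed _ _ (closure K) (x n @[n --> \oo])) => //.
- apply: closure_convex => _ _ t [q [qp qN] <-] [r [rp rN] <-] t01.
  exists (t *: q + (1 - t) *: r); last by rewrite linearP linearZ.
  split; first exact: probability_poly_convex.
  by move=> i iN; rewrite coefD !coefZ qN// rN// !mulr0 addr0.
- exact: closed_closure.
exists N => // n /= Nn; apply: subset_closure; exists 'X^n; last exact: psumXn.
split; first exact: probability_polyXn.
by move=> i iN; rewrite coefXn ltn_eqF// (leq_trans iN).
Qed.

(** The blocks are the supports of the polynomials. *)
Lemma psum_convex_block (q : nat -> {poly R}) x :
  (forall n, probability_poly (q n)) ->
  (forall n i, (q n.+1)`_i != 0 -> (size (q n) <= i)%N) ->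
  convex_block_sequence x (fun n => psum x (q n)).
Proof.
move=> qp qlt.
pose s n := [seq i <- iota 0 (size (q n)) | (q n)`_i != 0].
have sP n i : (i \in s n) = ((q n)`_i != 0).
  rewrite mem_filter mem_iota /= add0n.
  by have [//|h] := ltnP i (size (q n)); rewrite ?andbT// nth_default// eqxx.
have sum n (V : zmodType) (g : nat -> V) :
    (forall i, (q n)`_i = 0 -> g i = 0) ->
    \sum_(i <- [fset i in s n]%fset) g i = \sum_(0 <= i < size (q n)) g i.
  move=> g0; rewrite (perm_big (s n)); last first.
    apply: uniq_perm; [exact: fset_uniq|by rewrite filter_uniq ?iota_uniq|].
    by move=> i; rewrite inE.
  rewrite big_filter /index_iota subn0 big_mkcond; apply: eq_bigr => i _.
  by case: eqP => //= /g0 ->.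
have sum1 n : \sum_(i <- [fset i in s n]%fset) (q n)`_i = 1.
  by rewrite sum// -horner1_widen// (qp n).2.
exists (fun n => [fset i in s n]%fset), (fun n i => (q n)`_i); split => //.
- move=> n; apply/fset0Pn; apply: contrapT => h.
  have := sum1 n; rewrite big_seq big1 => [/esym/eqP|i iF].
    by rewrite oner_eq0.
  by exfalso; apply: h; exists i.
- move=> n i j; rewrite !inE !sP => iq /qlt; apply: leq_trans.
  by rewrite ltnNge; apply: contra iq => h; rewrite nth_default.
- move=> n i iF; rewrite (qp n).1/= -(sum1 n) (big_fsetD1 i)//=.
  by rewrite lerDl sumr_ge0// => j _; exact: (qp n).1.
- by move=> n; rewrite sum// => i ->; rewrite scale0r.
Qed.
End psum.

(** A weak limit [l] would be approximated by a convex combination of the first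
    [m] terms, on which [f m] vanishes, while [f m l] is close to [c]. *)
Lemma james_not_weakly_cvg {R : realType} {X : normedModType R} (c : R)
    (x : nat -> X) : james_sequence c x -> ~ exists l, weakly_cvg x l.
Proof.
move=> [c0 [f fP]] [l /weak_cvgP xl].
have c4 : 0 < c / 4 by rewrite divr_gt0.
have [q [_ _] lq] := mazur_tail xl 0 c4.
have [bf f0 fc] := fP (size q).
have fq : f (size q) (psum x q) = 0.
  rewrite /psum linear_sum big_nat_cond big1// => i /andP[/andP[_ iq] _].
  by rewrite linearZ /= f0// scaler0.
have fl : `|f (size q) l| <= c / 4.
  rewrite -[f _ l]subr0 -fq -linearB; exact: le_trans (bf _) (ltW lq).
have /cvgrPdist_lt/(_ _ c4)[N _ Nf] := xl _ bf.
have := fc (maxn N (size q)) (leq_maxr _ _).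
have := Nf (maxn N (size q)) (leq_maxl _ _) => /=.
set t := f _ (x _) => h1 h2.
have h3 : `|t - c| <= c / 8.
  apply: le_trans h2 _; rewrite ler_pM2l// lef_pV2 ?posrE ?exprn_gt0//.
  rewrite (_ : 8 = 2 ^+ 3 :> R) ?ler_eXn2l ?leq_addl ?ltr1n//.
  by rewrite !exprS expr0; lra.
have key (a b : R) : `|a| <= c / 4 -> `|a - b| < c / 4 -> `|b - c| <= c / 8 -> False.
  by rewrite !ler_norml ltr_norml => /andP[? ?] /andP[? ?] /andP[? ?]; lra.
exact: key fl h1 h3.
Qed.

(** * Shift-equivalent sequences in a set that is not weakly compact *)

Section shiftable.
Context {R : realType} {X : normedModType R}.
Implicit Types (u v x : nat -> X).

Definition shift_equivalent (L : R) u := 0 < L /\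
  forall p, equivalent_sequences L (fun n => u (n + p)%N) u.

Lemma sum_shift (V : zmodType) (p n : nat) (g : nat -> nat -> V) :
  \sum_(0 <= i < p + n) (if (i < p)%N then 0 else g (i - p)%N i) =
  \sum_(0 <= i < n) g i (i + p)%N.
Proof.
rewrite (big_cat_nat (leq0n p) (leq_addr _ _))/=.
rewrite big_nat_cond big1 ?add0r; last by move=> i /andP[/andP[_ ->] _].
rewrite -{1}(add0n p) big_addn addKn; apply: eq_bigr => i _.
by rewrite ltnNge leq_addl /= addnK.
Qed.

Lemma sum_shiftZ u (p n : nat) (a : nat -> R) :
  \sum_(0 <= i < p + n) (if (i < p)%N then 0 else a (i - p)%N) *: u i =
  \sum_(0 <= i < n) a i *: u (i + p)%N.
Proof.
rewrite -(sum_shift p n (fun j i => a j *: u i)).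
by apply: eq_bigr => i _; case: ifP => //; rewrite scale0r.
Qed.

Lemma l1_shift_equivalent (d M : R) u : 0 < d -> (forall n, `|u n| <= M) ->
  (forall n a, d * \sum_(0 <= i < n) `|a i| <= `|\sum_(0 <= i < n) a i *: u i|) ->
  shift_equivalent ((M + 1) / d) u.
Proof.
move=> d0 uM ul.
have M0 : 0 <= M by exact: le_trans (uM 0).
have upper p n a :
    `|\sum_(0 <= i < n) a i *: u (i + p)%N| <= (M + 1) * \sum_(0 <= i < n) `|a i|.
  apply: le_trans (ler_norm_sum _ _ _) _; rewrite mulr_sumr; apply: ler_sum => i _.
  rewrite normrZ mulrC ler_wpM2r// (le_trans (uM _))// lerDl//.
have lower p n a :
    \sum_(0 <= i < n) `|a i| <= `|\sum_(0 <= i < n) a i *: u (i + p)%N| / d.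
  rewrite ler_pdivlMr// mulrC -sum_shiftZ; apply: le_trans (ul _ _).
  rewrite ler_pM2l// -(sum_shift p n (fun j i => `|a j|)).
  by apply: ler_sum => i _; case: ifP => //; rewrite normr0.
split=> [|p n a]; first by rewrite divr_gt0// ltr_wpDl.
have L0 : 0 < (M + 1) / d by rewrite divr_gt0// ltr_wpDl.
have up0 : `|\sum_(0 <= i < n) a i *: u i| <= (M + 1) * \sum_(0 <= i < n) `|a i|.
  by have := upper 0 n a; under eq_bigr do rewrite addn0.
have lo0 : \sum_(0 <= i < n) `|a i| <= `|\sum_(0 <= i < n) a i *: u i| / d.
  by have := lower 0 n a; under [in X in _ <= X -> _]eq_bigr do rewrite addn0.
have M1 : 0 <= M + 1 by rewrite addr_ge0.
split; first rewrite ler_pdivrMl//; rewrite mulrAC -mulrA.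
  by apply: le_trans (upper p n a) _; rewrite ler_wpM2l.
by apply: le_trans up0 _; rewrite ler_wpM2l.
Qed.

(** The difference of the two combinations is at most the sum of the
    [|a i| * |u i - v i|]; the coefficient bound turns this into half the norm of
    the first combination. *)
Lemma james_perturbation (c : R) u v : james_sequence c u ->
  (forall n, `|u n - v n| <= c / 2 / 2 ^+ (n + 3)) ->
  forall n a,
    `|\sum_(0 <= i < n) a i *: u i| <= 2 * `|\sum_(0 <= i < n) a i *: v i| /\
    `|\sum_(0 <= i < n) a i *: v i| <= 2 * `|\sum_(0 <= i < n) a i *: u i|.
Proof.
move=> ju uv n a; have c0 : 0 < c := ju.1.
set su := \sum_(0 <= i < n) a i *: u i; set sv := \sum_(0 <= i < n) a i *: v i.
have h : `|su - sv| <= `|su| / 2.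
  rewrite /su /sv -sumrB; under eq_bigr do rewrite -scalerBr.
  apply: le_trans (ler_norm_sum _ _ _) _; rewrite -/su.
  apply: (@le_trans _ _ (\sum_(0 <= i < n) 4 / c * `|su| * (c / 2 / 2 ^+ (i + 3)))).
    rewrite big_nat_cond [leRHS]big_nat_cond; apply: ler_sum => i.
    move=> /andP[/andP[_ ni] _]; rewrite normrZ ler_pM//.
    exact: james_coefficient_le.
  rewrite -mulr_sumr -mulr_sumr.
  rewrite (_ : `|su| / 2 = 4 / c * `|su| * (c / 2 * 4^-1)); last first.
    by field; rewrite gt_eqF.
  apply: ler_wpM2l; first by rewrite mulr_ge0// divr_ge0// ltW.
  by rewrite ler_wpM2l ?tail_geometric_le// divr_ge0// ltW.
have h1 : `|su| <= `|su - sv| + `|sv|.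
  by rewrite -{1}(subrK sv su) ler_normD.
have h2 : `|sv| <= `|su - sv| + `|su|.
  by rewrite distrC -{1}(subrK su sv) ler_normD.
have su0 := normr_ge0 su; have sv0 := normr_ge0 sv.
by split; lra.
Qed.

Lemma shift_equivalent_perturbation (c L : R) u v : james_sequence c u ->
  (forall n, `|u n - v n| <= c / 2 / 2 ^+ (n + 3)) ->
  shift_equivalent L v -> shift_equivalent (4 * L) u.
Proof.
move=> ju uv [L0 vL]; have uv2 := james_perturbation ju uv.
have uv2p p n a :
    `|\sum_(0 <= i < n) a i *: u (i + p)%N| <=
      2 * `|\sum_(0 <= i < n) a i *: v (i + p)%N| /\
    `|\sum_(0 <= i < n) a i *: v (i + p)%N| <=
      2 * `|\sum_(0 <= i < n) a i *: u (i + p)%N|.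
  by rewrite -!sum_shiftZ; exact: uv2.
split=> [|p n a]; first by rewrite mulr_gt0.
have [h1 h2] := uv2p p n a; have [h3 h4] := uv2 n a; have [h5 h6] := vL p n a.
move: h5; rewrite ler_pdivrMl// => h5.
have L4 : 0 < 4 * L by rewrite mulr_gt0.
rewrite ler_pdivrMl//; split.
  apply: le_trans h1 _; rewrite (_ : 4 * L = 2 * (L * 2)); last by ring.
  rewrite -mulrA ler_pM2l// (le_trans h5)// -mulrA ler_pM2l//.
apply: le_trans h3 _; rewrite (_ : 4 * L = 2 * (L * 2)); last by ring.
by rewrite -mulrA ler_pM2l// (le_trans h6)// -mulrA ler_pM2l.
Qed.

(** Each polynomial is taken from [mazur_tail] beyond the degrees of all the
    previous ones. *)
Lemma small_convex_blocks x (e : nat -> R) :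
  (forall f, dual_ball f -> f (x n) @[n --> \oo] --> f 0) ->
  (forall n, 0 < e n) ->
  exists q : nat -> {poly R}, [/\ forall n, probability_poly (q n),
    forall n i, (q n.+1)`_i != 0 -> (size (q n) <= i)%N
    & forall n, `|psum x (q n)| <= e n].
Proof.
move=> x0 e0.
pose P (s : seq {poly R}) q := [/\ probability_poly q,
  forall r, r \in s -> forall i, q`_i != 0 -> (size r <= i)%N
  & `|psum x q| <= e (size s)].
have [|q qP] := @history_choice _ P.
  move=> s; have [q [qp qN] xq] := mazur_tail x0 (\max_(r <- s) size r) (e0 (size s)).
  exists q; split=> //; last by move: xq; rewrite sub0r normrN => /ltW.
  move=> r rs i qi; rewrite leqNgt; apply/negP => ir; move/eqP: qi; apply.
  apply: qN; apply: leq_trans ir _.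
  exact: (leq_bigmax_seq (F := fun r : {poly R} => size r)).
exists q; split=> n; first by case: (qP n).
  move=> i; have [_ h _] := qP n.+1; apply: h.
  by apply: map_f; rewrite mem_iota/=.
by have [_ _] := qP n; rewrite size_mkseq.
Qed.
End shiftable.

(** In the weak Cauchy case the same polynomials [q n] produce convex blocks of
    [x'] in [C] and convex blocks of [y], which are shift equivalent. *)
Lemma shift_equivalent_james_sequence {R : realType}
    {X : completeNormedModType R} (C : set X) :
  property_su X -> closed C -> convex_closed C -> bounded_set C ->
  ~ weakly_compact C ->
  exists (c L : R) (u : nat -> X),
    [/\ james_sequence c u, shift_equivalent L u & forall n, C (u n)].
Proof.
move=> su clC cC bC nC.
have [c [x0 [jx0 Cx0]]] := james_sequence_exists clC cC bC nC.
have [M [_ MC]] := bC.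
have x0M n : `|x0 n| <= M + 1 by apply: (MC (M + 1)); rewrite ?ltrDl.
have [m mi mP] := rosenthal_dichotomy x0M.
pose x := x0 \o m.
have jx : james_sequence c x.
  apply: james_convex_block jx0 _; apply: convex_block_of_subsequence.
  by exists m.
have Cx n : C (x n) by exact: Cx0.
case: mP => [wcx|[d d0 xd]]; last first.
  exists c, ((M + 1 + 1) / d), x; split=> //.
  by apply: l1_shift_equivalent => // n; exact: x0M.
have [|w [_ [L [L0 [y [k ki yE] yL]]]] xw] := su x.
  by split=> //; exact: james_not_weakly_cvg jx.
pose x' := x \o k.
have x'x : convex_block_sequence x x'.
  by apply: convex_block_of_subsequence; exists k.
have jx' : james_sequence c x' by exact: james_convex_block jx x'x.
have Cx' n : C (x' n) by exact: Cx.
have c0 : 0 < c := jx.1.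
have koo : k @ \oo --> \oo.
  have kn n : (n <= k n)%N.
    elim: n => // n IHn; exact: leq_ltn_trans IHn (ki _ _ (ltnSn n)).
  move=> B [N _ NB]; exists N => // n /= Nn; apply: NB => /=.
  exact: leq_trans Nn (kn n).
have [f bf| |q [qp qlt qe]] := @small_convex_blocks _ _ (fun n => x' n - y n)
    (fun n => c / 2 / 2 ^+ (n + 3)).
- move/weak_cvgP : xw => /(_ f bf) fxw.
  rewrite (_ : (fun n => f (x' n - y n)) = (fun n => f (x n - w n)) \o k).
    exact: cvg_comp koo fxw.
  by apply/funext => n; rewrite yE.
- by move=> n; rewrite !divr_gt0// exprn_gt0.
have vb := psum_convex_block y qp qlt; have ub := psum_convex_block x' qp qlt.
exists c, (4 * L), (fun n => psum x' (q n)).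
have ju : james_sequence c (fun n => psum x' (q n)).
  exact: james_convex_block jx' ub.
split=> //; last exact: convex_block_in cC Cx' ub.
apply: (shift_equivalent_perturbation (v := fun n => psum y (q n)) ju).
  move=> n; rewrite /psum -sumrB; under eq_bigr do rewrite -scalerBr.
  exact: qe.
by split=> // p; exact: yL.
Qed.

(** * The shift map *)

Section shift_map.
Context {R : realType} {X : completeNormedModType R}.
Context (c L : R) (u : nat -> X).
Context (ju : james_sequence c u) (uL : shift_equivalent L u).

Let T := psum u.
Let K := closure (T @` probability_poly).

Lemma psum_shift_norm (p : nat) (q : {poly R}) :
  `|T q| <= L * `|T ('X^p * q)| /\ `|T ('X^p * q)| <= L * `|T q|.
Proof.
case: uL => L0 h; have [h1 h2] := h p (size q) (fun i => q`_i).
by rewrite /T psum_shift; split=> //; rewrite -ler_pdivrMl.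
Qed.

Lemma psum_shift_dist (p : nat) (q r : {poly R}) :
  `|T q - T r| <= L * `|T ('X^p * q) - T ('X^p * r)| /\
  `|T ('X^p * q) - T ('X^p * r)| <= L * `|T q - T r|.
Proof.
have := psum_shift_norm p (q - r).
by rewrite /T mulrBr !linearB.
Qed.

Lemma shift_hull_approx x e : K x -> 0 < e ->
  exists2 q, probability_poly q & `|x - T q| < e.
Proof.
by move=> /closure_normP Kx /Kx[_ [q qp <-] xq]; exists q.
Qed.

(** The Lipschitz extension of [T q |-> T ('X * q)] to the closure.  It is
    characterized by its distances to the values [T ('X * q)], which avoids
    manipulating limits afterwards. *)
Lemma shift_map_exists :
  exists f : X -> X, forall x, K x ->
    forall q : {poly R}, `|f x - T ('X * q)| <= L * `|x - T q|.
Proof.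
have L0 : 0 < L := uL.1.
have /choice[f fP] : forall x, exists y, K x ->
    forall q : {poly R}, `|y - T ('X * q)| <= L * `|x - T q|; last by exists f.
move=> x; have [Kx|nKx] := pselect (K x); last by exists 0.
have /choice[r rP] : forall n : nat, exists q : {poly R},
    `|x - T q| <= n.+1%:R^-1.
  move=> n; have n0 : 0 < n.+1%:R^-1 :> R by rewrite invr_gt0.
  by have [q _ /ltW xq] := shift_hull_approx Kx n0; exists q.
have [|m n mn|y uy] := @cauchy_norm_cvg R X (fun n => T ('X * r n))
    (fun n => L * 2 * n.+1%:R^-1).
- by rewrite -(mulr0 (L * 2)); apply: cvgMl_tmp; exact: cvg_harmonic.
- have := (psum_shift_dist 1 (r m) (r n)).2; rewrite expr1 => /le_trans; apply.
  rewrite /= -mulrA ler_pM2l//.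
  have nm : (n.+1%:R^-1 : R) <= m.+1%:R^-1 by rewrite lef_pV2 ?posrE// ler_nat ltnS.
  rewrite -(subrKA x) (le_trans (ler_normD _ _))// distrC mulr_natl mulr2n.
  by rewrite lerD// (le_trans (rP n)).
exists y => _ q; apply/ler_addgt0Pr => e e0.
have e1 : 0 < e / 2 by rewrite divr_gt0.
have e2 : 0 < e / 2 / L by rewrite divr_gt0.
near \oo => n.
have h1 : `|y - T ('X * r n)| <= e / 2.
  by apply/ltW; near: n; move/cvgrPdist_lt : uy; exact.
have h2 : `|x - T (r n)| <= e / 2 / L.
  apply: le_trans (rP n) _; apply/ltW.
  by near: n; exact: near_infty_natSinv_lt (PosNum e2).
have := (psum_shift_dist 1 (r n) q).2; rewrite expr1 => h3.
have h4 : `|T (r n) - T q| <= e / 2 / L + `|x - T q|.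
  by rewrite -(subrKA x) (le_trans (ler_normD _ _))// lerD2r distrC.
have h5 : L * `|T (r n) - T q| <= e / 2 + L * `|x - T q|.
  have := h4; rewrite -(ler_pM2l L0) mulrDr (mulrC L (e / 2 / L)) divfK//.
  by rewrite gt_eqF.
rewrite -(subrKA (T ('X * r n))) (le_trans (ler_normD _ _))//; lra.
Unshelve. all: by end_near. Qed.

Context (f : X -> X).
Context (fP : forall x, K x ->
  forall q : {poly R}, `|f x - T ('X * q)| <= L * `|x - T q|).

(** Compare [u] with its shift by 0; [u 0] is nonzero. *)
Lemma shift_constant_ge1 : 1 <= L.
Proof.
have [c0 [g gP]] := ju; have [_ _ /(_ 0 isT)] := gP 0.
have [->|u0 _] := eqVneq (u 0) 0.
  rewrite linear0 sub0r normrN gtr0_norm// ler_pdivlMr ?exprn_gt0//.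
  by rewrite ger_pMr// !exprS expr0 => ?; exfalso; lra.
have := (psum_shift_norm 0 1).1; rewrite expr0 mulr1 /T -(expr0 'X) psumXn.
by rewrite -[X in X <= _]mul1r ler_pM2r// normr_gt0.
Qed.

(** The constant [L] is the same for all iterates because shift equivalence is
    uniform in the shift. *)
Lemma iter_shift_map (p : nat) x : K x -> K (iter p f x) /\
  forall q : {poly R}, `|iter p f x - T ('X^p * q)| <= L * `|x - T q|.
Proof.
have L0 : 0 < L := uL.1.
move=> Kx.
have inK n y : (forall q : {poly R}, `|y - T ('X^n * q)| <= L * `|x - T q|) -> K y.
  move=> yP; apply/closure_normP => e e0.
  have [r rp xr] := shift_hull_approx Kx (divr_gt0 e0 L0).
  exists (T ('X^n * r)); first by exists ('X^n * r) => //; exact: probability_polyM.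
  by apply: le_lt_trans (yP r) _; rewrite mulrC -ltr_pdivlMr.
suff h : forall q : {poly R}, `|iter p f x - T ('X^p * q)| <= L * `|x - T q|.
  by split=> //; exact: inK h.
elim: p => [|p IHp] q.
  by rewrite expr0 mul1r /= ler_peMl// shift_constant_ge1.
set y := iter p f x in IHp *.
have Ky : K y by exact: inK IHp.
apply/ler_addgt0Pr => e e0.
have LL : 0 < L * L + L by rewrite addr_gt0// mulr_gt0.
have d0 : 0 < e / (L * L + L) by rewrite divr_gt0.
have [r rp xr] := shift_hull_approx Kx d0.
set d := e / _ in d0 xr.
have de : e = (L * L + L) * d by rewrite /d mulrC divfK// gt_eqF.
have h1 : `|f y - T ('X^(p.+1) * r)| <= L * (L * d).
  rewrite exprS -mulrA; apply: le_trans (fP Ky _) _; rewrite ler_pM2l//.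
  by apply: le_trans (IHp r) _; rewrite ler_pM2l// ltW.
have h2 := (psum_shift_dist p.+1 r q).2.
have h3 : L * `|T r - T q| <= L * (d + `|x - T q|).
  rewrite ler_pM2l// -(subrKA x) (le_trans (ler_normD _ _))// lerD2r distrC.
  exact: ltW.
rewrite iterS -/y -(subrKA (T ('X^(p.+1) * r))) (le_trans (ler_normD _ _))// de.
by lra.
Qed.

Lemma shift_map_bilipschitz : uniformly_bilipschitz K f.
Proof.
have L0 : 0 < L := uL.1.
have Li : 0 < L^-1 by rewrite invr_gt0.
exists L^-1, L; split=> // x y Kx Ky p.
have [_ xp] := iter_shift_map p Kx; have [_ yp] := iter_shift_map p Ky.
set fx := iter p f x in xp *; set fy := iter p f y in yp *.
have approx e : 0 < e -> exists q r,
    [/\ `|x - T q| <= e, `|y - T r| <= e, `|fx - T ('X^p * q)| <= L * e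
     & `|fy - T ('X^p * r)| <= L * e].
  move=> e0; have [q _ /ltW xq] := shift_hull_approx Kx e0.
  have [r _ /ltW yr] := shift_hull_approx Ky e0; exists q, r; split=> //.
    by apply: le_trans (xp q) _; rewrite ler_pM2l.
  by apply: le_trans (yp r) _; rewrite ler_pM2l.
have dist (a b a' b' : X) : `|a - b| <= `|a - a'| + `|a' - b'| + `|b - b'|.
  rewrite (distrC b) -(subrKA a') (le_trans (ler_normD _ _))// -addrA lerD2l.
  by rewrite -(subrKA b') ler_normD.
rewrite ler_pdivrMl//; apply/andP; split; apply/ler_addgt0Pr => e e0.
  have L2 : 0 < 2 + 2 * (L * L) by rewrite addr_gt0// !mulr_gt0.
  have d0 : 0 < e / (2 + 2 * (L * L)) by rewrite divr_gt0.
  have [q [r [h1 h2 h3 h4]]] := approx _ d0; set d := e / _ in d0 h1 h2 h3 h4.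
  have de : e = (2 + 2 * (L * L)) * d by rewrite /d mulrC divfK// gt_eqF.
  have := dist x y (T q) (T r).
  have := (psum_shift_dist p q r).1; have := dist (T ('X^p * q)) (T ('X^p * r)) fx fy.
  rewrite (distrC (T _) fx) (distrC (T _) fy) => h5 h6 h7.
  have h8 : L * `|T ('X^p * q) - T ('X^p * r)| <= L * (L * d + `|fx - fy| + L * d).
    by rewrite ler_pM2l//; lra.
  rewrite de; lra.
have L4 : 0 < 4 * L by rewrite mulr_gt0.
have d0 : 0 < e / (4 * L) by rewrite divr_gt0.
have [q [r [h1 h2 h3 h4]]] := approx _ d0; set d := e / _ in d0 h1 h2 h3 h4.
have de : e = (4 * L) * d by rewrite /d mulrC divfK// gt_eqF.
have := dist fx fy (T ('X^p * q)) (T ('X^p * r)).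
have := (psum_shift_dist p q r).2; have := dist (T q) (T r) x y.
rewrite (distrC (T _) x) (distrC (T _) y) => h5 h6 h7.
have h8 : L * `|T q - T r| <= L * (d + `|x - y| + d) by rewrite ler_pM2l//; lra.
rewrite de; lra.
Qed.

Lemma shift_map_affine : affine_on K f.
Proof.
have L0 : 0 < L := uL.1.
move=> x y Kx Ky t t01.
have Kz : K (t *: x + (1 - t) *: y).
  apply: closure_convex Kx Ky t01 => _ _ s [q qp <-] [r rp <-] s01.
  exists (s *: q + (1 - s) *: r); first exact: probability_poly_convex.
  by rewrite /T linearP linearZ.
have /andP[t0 t1] := t01.
set z := t *: x + _; set w := t *: f x + _.
apply/eqP; rewrite -subr_eq0 -normr_le0; apply/ler_addgt0Pr => e e0; rewrite add0r.
have L2 : 0 < 2 * L by rewrite mulr_gt0.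
have d0 : 0 < e / (2 * L) by rewrite divr_gt0.
have [q _ /ltW xq] := shift_hull_approx Kx d0.
have [r _ /ltW yr] := shift_hull_approx Ky d0.
set d := e / _ in d0 xq yr.
have de : e = L * d + L * d.
  by rewrite -mulr2n -mulr_natl mulrA /d mulrC divfK// gt_eqF.
have conv (a b a' b' : X) (k : R) : `|a - a'| <= k -> `|b - b'| <= k ->
    `|(t *: a + (1 - t) *: b) - (t *: a' + (1 - t) *: b')| <= k.
  move=> ha hb; rewrite opprD addrACA -!scalerBr (le_trans (ler_normD _ _))//.
  rewrite !normrZ !ger0_norm ?subr_ge0//.
  have -> : k = t * k + (1 - t) * k by rewrite mulrBl mul1r addrC subrK.
  by rewrite lerD// ler_wpM2l// subr_ge0.
pose s := t *: q + (1 - t) *: r.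
have h1 : `|f z - T ('X * s)| <= L * d.
  apply: le_trans (fP Kz s) _; rewrite ler_pM2l// /s /T linearP linearZ.
  exact: conv.
have h2 : `|w - T ('X * s)| <= L * d.
  have -> : 'X * s = t *: ('X * q) + (1 - t) *: ('X * r).
    by rewrite mulrDr !scalerAr.
  rewrite /T linearP linearZ /=.
  apply: conv.
    by apply: le_trans (fP Kx q) _; rewrite ler_pM2l.
  by apply: le_trans (fP Ky r) _; rewrite ler_pM2l.
rewrite -(subrKA (T ('X * s))) (le_trans (ler_normD _ _))// de lerD//.
by rewrite distrC.
Qed.

(** The functional [g n] of the James sequence vanishes on [T q] when
    [size q <= n], and is at least [7 c / 8] on the [n]-th shift of the hull. *)
Lemma shift_map_separation x y : K x -> K y ->
  \forall n \near \oo, c / 4 <= `|x - iter n f y|.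
Proof.
have L0 : 0 < L := uL.1.
have [c0 [g gP]] := ju.
move=> Kx Ky.
have c8 : 0 < c / 8 by rewrite divr_gt0.
have [q _ /ltW xq] := shift_hull_approx Kx c8.
have [r [r0 r1] /ltW yr] := shift_hull_approx Ky (divr_gt0 c8 L0).
exists (size q) => // n /= qn.
have [bg g0 gc] := gP n; have [_ /(_ r) yn] := iter_shift_map n Ky.
set fy := iter n f y in yn *.
have h1 : `|fy - T ('X^n * r)| <= c / 8.
  by apply: le_trans yn _; rewrite mulrC -ler_pdivlMr.
have gq : g n (T q) = 0.
  rewrite /T /psum linear_sum big_nat_cond big1// => i /andP[/andP[_ iq] _].
  by rewrite linearZ /= g0 ?scaler0// (leq_trans iq).
have gr : 7 * c / 8 <= (g n (T ('X^n * r)) : R).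
  rewrite /T psum_shift /psum linear_sum /=.
  have -> : 7 * c / 8 = \sum_(0 <= i < size r) r`_i * (7 * c / 8).
    by rewrite -mulr_suml -horner1_widen// r1 mul1r.
  apply: ler_sum => i _; rewrite linearZ /= ler_wpM2l//.
  have := gc (i + n)%N (leq_addl _ _).
  have : c / 2 ^+ (i + n + 3) <= c / 8.
    rewrite ler_pM2l// lef_pV2 ?posrE ?exprn_gt0//.
    rewrite (_ : 8 = 2 ^+ 3 :> R) ?ler_eXn2l ?leq_addl ?ltr1n//.
    by rewrite !exprS expr0; lra.
  move: (g n _ : R) => a h2; rewrite ler_norml => /andP[h3 h4]; lra.
have h2 : 7 * c / 8 <= `|T q - T ('X^n * r)|.
  apply: le_trans gr _; rewrite distrC -[leLHS]subr0 -gq -linearB.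
  exact: le_trans (ler_norm _) (bg _).
have h3 : `|T q - T ('X^n * r)| <= `|x - T q| + `|x - fy| + `|fy - T ('X^n * r)|.
  rewrite (distrC x (T q)) -(subrKA x) (le_trans (ler_normD _ _))// -addrA lerD2l.
  by rewrite -(subrKA fy) ler_normD.
lra.
Qed.
End shift_map.

(** * Fixed points on weakly compact sets *)

(** The Cesaro means of an orbit are almost fixed, and almost fixed points form
    closed convex sets, so a weak limit of the means is fixed. *)
Lemma affine_fixed_point {R : realType} {X : normedModType R} (C K : set X)
    (f : X -> X) : weakly_compact C -> bcc_subsets C K -> set_fun K K f ->
  uniformly_bilipschitz K f -> affine_on K f -> exists2 x, K x & f x = x.
Proof.
move=> wC [KC [x0 Kx0] [M [_ KM]] clK /convex_setP cK] fK [k [l [_ l0 fl]]] af.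
have Kn n : K (iter n f x0) by elim: n => // n IHn; exact: fK.
have mean n : exists2 a, K a & n.+1%:R *: (f a - a) = iter n.+1 f x0 - x0.
  elim: n => [|n [a Ka aE]]; first by exists x0; rewrite // scale1r.
  have n2 : (n.+2%:R : R) != 0 by rewrite pnatr_eq0.
  pose t : R := n.+1%:R / n.+2%:R.
  have t01 : 0 <= t <= 1.
    by rewrite divr_ge0//= ler_pdivrMr ?ltr0n// mul1r ler_nat.
  exists (t *: a + (1 - t) *: iter n.+1 f x0); first exact: cK.
  rewrite af// opprD addrACA -!scalerBr scalerDr !scalerA.
  have -> : n.+2%:R * t = n.+1%:R by rewrite mulrC divfK.
  have -> : n.+2%:R * (1 - t) = 1.
    by rewrite mulrBr mulr1 mulrC divfK// -[n.+2%:R]natr1 addrC addKr.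
  by rewrite scale1r aE addrC -iterS subrKA.
have KM1 y : K y -> `|y| <= M + 1 by apply: KM; rewrite ltrDl.
have /choice[a aP] : forall n, exists a, K a /\
    `|f a - a| <= (2 * (M + 1)) * n.+1%:R^-1.
  move=> n; have [a Ka aE] := mean n; exists a; split=> //.
  rewrite ler_pdivlMr ?ltr0n// mulrC -[X in X * _]ger0_norm// -normrZ aE.
  rewrite mulr_natl mulr2n (le_trans (ler_normB _ _))// lerD ?KM1//.
have [U [UU aU]] := ultraFilterLemma (fmap_proper_filter a eventually_filter).
have UC : U C by apply: aU; exists 0 => // n _; apply: KC; case: (aP n).
have [z0 [_ Uz0]] : C `&` [set p : weak X | U --> p] !=set0.
  by move: wC; rewrite /weakly_compact compact_ultra; exact.
have UP : ProperFilter U by exact: ultra_proper.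
have [x Ux] : exists x : X,
    forall g : {linear X -> R^o}, dual_ball g -> g y @[y --> U] --> g x.
  by exists z0; exact/weak_cvgP.
pose D e := [set x | K x /\ `|f x - x| <= e].
have Dx e : 0 < e -> D e x.
  move=> e0; apply: (convex_closed_weak_closed UP _ _ _ Ux).
  - move=> y z t [Ky ye] [Kz ze] /[dup] t01 /andP[t0 t1]; split; first exact: cK.
    rewrite af// opprD addrACA -!scalerBr (le_trans (ler_normD _ _))//.
    rewrite !normrZ !ger0_norm ?subr_ge0//.
    have -> : e = t * e + (1 - t) * e by rewrite mulrBl mul1r addrC subrK.
    by rewrite lerD// ler_wpM2l// subr_ge0.
  - move=> y /closure_normP Dy.
    have Ky : K y.
      by apply: clK; apply/closure_normP => d /Dy[z [Kz _] yz]; exists z.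
    split=> //; apply/ler_addgt0Pr => d d0.
    have l1 : 0 < l + 1 by rewrite addr_gt0.
    have [z [Kz ze] yz] := Dy _ (divr_gt0 d0 l1).
    have /andP[_ fyz] := fl y z Ky Kz 1; rewrite /= in fyz.
    have h : (l + 1) * `|y - z| <= d by rewrite mulrC -ler_pdivlMr// ltW.
    rewrite -(subrKA (f z)) (le_trans (ler_normD _ _))//.
    have : `|f z - y| <= `|f z - z| + `|y - z|.
      by rewrite (distrC y) -(subrKA z) ler_normD.
    by move: fyz ze h; lra.
  - apply: aU.
    have : 2 * (M + 1) * n.+1%:R^-1 @[n --> \oo] --> (0 : R).
      by rewrite -(mulr0 (2 * (M + 1))); apply: cvgMl_tmp; exact: cvg_harmonic.
    move/cvgrPdist_lt => /(_ e e0); apply: filterS => n.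
    rewrite sub0r normrN => /ltW h; split; first by case: (aP n).
    by apply: le_trans (aP n).2 _; apply: le_trans h; exact: ler_norm.
exists x; first by case: (Dx 1).
apply/eqP; rewrite -subr_eq0 -normr_le0; apply/ler_addgt0Pr => e e0.
by rewrite add0r; case: (Dx e).
Qed.

(** * Weak compactness and the fixed point property *)

Lemma limn_einf_ge {R : realType} (r : R) (v : nat -> \bar R) :
  (\forall n \near \oo, (r%:E <= v n)%E) -> (r%:E <= limn_einf v)%E.
Proof.
move=> [N _ Nv]; rewrite limn_einf_lim; apply: lime_ge; first exact: is_cvg_einfs.
exists N => // n /= Nn; apply: le_ereal_inf_tmp => _ [k /= nk <-].
by apply: Nv => /=; exact: leq_trans nk.
Qed.

Theorem theorem7p12 (R : realType) (X : completeNormedModType R)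
    (suX : property_su X) (C : set X) (CB : bcc_subsets [set: X] C) :
  weakly_compact C <->
  generic_fpp
    (fun (K : set X) (f : X -> X) =>
       [/\ uniformly_bilipschitz K f, affine_on K f & (0 < theta K f)%E])
    C.
Proof.
split=> [wC K KB f fK [lf af _]|fpp].
  exact: affine_fixed_point wC KB fK lf af.
have [_ _ bC clC /convex_setP cC] := CB.
apply: contrapT => nC.
have [c [L [u [ju uL Cu]]]] := shift_equivalent_james_sequence suX clC cC bC nC.
have [f fP] := shift_map_exists uL.
pose K := closure (psum u @` probability_poly).
have KC : K `<=` C.
  rewrite (closure_id C).1//; apply: closureS => _ [q [q0 q1] <-].
  have [||||y Cy yE] := @convex_closed_sum _ _ C _ (index_iota 0 (size q))
      (fun i => q`_i) u => //; first by exists (u 0).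
  by rewrite /psum yE -horner1_widen// q1 scale1r.
have c0 : 0 < c := ju.1.
have bil := shift_map_bilipschitz ju uL fP.
have aff := shift_map_affine uL fP.
have sep := shift_map_separation ju uL fP.
have KB : bcc_subsets C K.
  split=> //.
  - exists (psum u 1); apply: subset_closure; exists 1 => //.
    by rewrite -(expr0 'X); exact: probability_polyXn.
  - by have [M [Mr MC]] := bC; exists M; split=> // y My k /KC; exact: MC.
  - exact: closed_closure.
  - apply/convex_setP; apply: closure_convex => _ _ t [q qp <-] [r rp <-] t01.
    exists (t *: q + (1 - t) *: r); first exact: probability_poly_convex.
    by rewrite linearP linearZ.
have [x Kx fx] : exists2 x, K x & f x = x.
  apply: (fpp K KB f).
    by move=> x Kx; have [] := iter_shift_map ju uL fP 1 Kx.
  split; [exact: bil|exact: aff|].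
  apply: (@lt_le_trans _ _ (c / 4)%:E); first by rewrite lte_fin divr_gt0.
  apply: le_ereal_inf_tmp => _ [x Kx [y Ky <-]]; apply: limn_einf_ge.
  by apply: filterS (sep x y Kx Ky) => n; rewrite lee_fin.
have [n] := filter_ex (sep x x Kx Kx).
have -> : iter n f x = x by elim: n => //= n ->.
by rewrite subrr normr0 leNgt divr_gt0.
Qed.
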